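(* For any integers $n,m\ge1$, the system $f_{m+1,n}(x)=f_{m+2,n}(x)=\cdots=f_{m+n,n}(x)=0$, where $$f_{d,n}(x)=\sum_{k=0}^{d}(-1)^k\binom{d}{k}x_1^{k}x_2^{k^2}\cdots x_n^{k^n},$$ has a root at $\mathbf{1}=(1,\dots,1)$ of multiplicity at least $\binom{n+m}{n}$.
   Context: $x=(x_1,\dots,x_n)$. The multiplicity of an isolated solution of a system of $n$ polynomials in $n$ variables is the complex dimension of the localization at that point of the quotient of the polynomial ring by the ideal they generate. *)

(* Defs.v *)
From HB Require Import structures.
From mathcomp Require Import all_boot all_order all_algebra.
From mathcomp Require Import generic_quotient ring_quotient.
From mathcomp Require Import boolp classical_sets reals topology complex.
From mathcomp Require Import mpoly ring.

Set Implicit Arguments.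
Unset Strict Implicit.
Unset Printing Implicit Defensive.

Import Order.TTheory GRing.Theory Num.Theory.
Local Open Scope ring_scope.
Local Open Scope quotient_scope.
Local Open Scope classical_set_scope.
Local Open Scope complex_scope.

(* ring_quotient equips {ideal_quot I} with a ring structure only; when the
   ring is a K-algebra, so is its quotient. *)
Section QuotientAlgebra.
Variables (K : comNzRingType) (A : comAlgType K) (I : idealr A).

Definition quot_scale (c : K) (x : {ideal_quot I}) : {ideal_quot I} :=
  \pi_{ideal_quot I} (c *: (repr x : A)).

Lemma pi_scale (c : K) (x : A) :
  quot_scale c (\pi_{ideal_quot I} x) = \pi_{ideal_quot I} (c *: x).
Proof.
apply/eqP; rewrite /quot_scale -Quotient.idealrBE -scalerBr -mulr_algl.
by rewrite idealMr // Quotient.idealrBE reprK.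
Qed.

Let scaleA a b v : quot_scale a (quot_scale b v) = quot_scale (a * b) v.
Proof. by rewrite -[v]reprK (pi_scale b (repr v)) !pi_scale scalerA. Qed.

Let scale1 : left_id 1 quot_scale.
Proof. by move=> v; rewrite -[v]reprK pi_scale scale1r. Qed.

Let scaleDr : right_distributive quot_scale +%R.
Proof.
by move=> a u v; rewrite -[u]reprK -[v]reprK -rmorphD !pi_scale scalerDr rmorphD.
Qed.

Let scaleDl v : {morph quot_scale^~ v : a b / a + b}.
Proof. by move=> a b /=; rewrite -[v]reprK !pi_scale scalerDl rmorphD. Qed.

HB.instance Definition _ := GRing.Zmodule_isLmodule.Build K {ideal_quot I}
  scaleA scale1 scaleDr scaleDl.

Let scaleAl (a : K) (u v : {ideal_quot I}) : a *: (u * v) = (a *: u) * v.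
Proof.
change (quot_scale a (u * v) = quot_scale a u * v).
by rewrite -[u]reprK -[v]reprK -rmorphM !pi_scale -rmorphM scalerAl.
Qed.

HB.instance Definition _ :=
  GRing.Lmodule_isLalgebra.Build K {ideal_quot I} scaleAl.
HB.instance Definition _ := GRing.Lalgebra_isComAlgebra.Build K {ideal_quot I}.

End QuotientAlgebra.

(* The localization S^-1 A: fractions x / s with s in S, where
   x / s = y / t iff u (x t - y s) = 0 for some u in S. *)
Section Localization.
Variables (K : comNzRingType) (A : comAlgType K) (S : mulrClosed A).

Definition frac : Type := (A * {s : A | s \in S})%type.
HB.instance Definition _ := Choice.on frac.

Definition mkfrac (x s : A) (Ss : s \in S) : frac := (x, exist _ s Ss).
Definition fnum (p : frac) : A := p.1.
Definition fden (p : frac) : A := val p.2.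

Lemma fdenS p : fden p \in S. Proof. exact: valP p.2. Qed.

Definition frac_eq (p q : frac) : bool :=
  `[< exists2 u, u \in S & u * (fnum p * fden q - fnum q * fden p) = 0 >].

Lemma frac_eq_class : equiv_class_of frac_eq.
Proof.
split=> [p|p q|q p r].
- by apply/asboolP; exists 1; rewrite ?rpred1 // subrr mulr0.
- by apply/asboolP/asboolP => -[u Su E]; exists u => //;
    rewrite -opprB mulrN E oppr0.
- move=> /asboolP[u Su E] /asboolP[v Sv F].
  apply/asboolP; exists (u * v * fden q); first by rewrite !rpredM // fdenS.
  rewrite (_ : _ * _ = v * fden r * (u * (fnum p * fden q - fnum q * fden p))
    + u * fden p * (v * (fnum q * fden r - fnum r * fden q))); last by ring.
  by rewrite E F !mulr0 addr0.
Qed.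

Canonical frac_eq_equiv := EquivRelPack frac_eq_class.
Canonical frac_eq_encModRel := defaultEncModRel frac_eq.

Definition localization : Type := {eq_quot frac_eq}.
HB.instance Definition _ := Choice.on localization.
HB.instance Definition _ : EqQuotient frac frac_eq localization :=
  EqQuotient.on localization.

Definition loc_class (p : frac) : localization := \pi_localization p.

Lemma loc_classP p q :
  loc_class p = loc_class q <->
  exists2 u, u \in S & u * (fnum p * fden q - fnum q * fden p) = 0.
Proof.
by split=> [/eqP|H]; [|apply/eqP]; rewrite eqmodE; [move/asboolP|apply/asboolP].
Qed.

Lemma loc_ind (P : localization -> Prop) :
  (forall p, P (loc_class p)) -> forall x, P x.
Proof. by move=> H x; rewrite -[x]reprK; exact: H. Qed.

Definition frac0 : frac := mkfrac 0 (rpred1 S).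
Definition frac1 : frac := mkfrac 1 (rpred1 S).
Definition frac_opp (p : frac) : frac := mkfrac (- fnum p) (fdenS p).
Definition frac_add (p q : frac) : frac :=
  mkfrac (fnum p * fden q + fnum q * fden p) (rpredM (fdenS p) (fdenS q)).
Definition frac_mul (p q : frac) : frac :=
  mkfrac (fnum p * fnum q) (rpredM (fdenS p) (fdenS q)).
Definition frac_scale (c : K) (p : frac) : frac :=
  mkfrac (c *: fnum p) (fdenS p).

Lemma frac0E : (fnum frac0 = 0) * (fden frac0 = 1). Proof. by []. Qed.
Lemma frac1E : (fnum frac1 = 1) * (fden frac1 = 1). Proof. by []. Qed.
Lemma frac_oppE p :
  (fnum (frac_opp p) = - fnum p) * (fden (frac_opp p) = fden p).
Proof. by []. Qed.
Lemma frac_addE p q :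
  (fnum (frac_add p q) = fnum p * fden q + fnum q * fden p)
  * (fden (frac_add p q) = fden p * fden q).
Proof. by []. Qed.
Lemma frac_mulE p q :
  (fnum (frac_mul p q) = fnum p * fnum q)
  * (fden (frac_mul p q) = fden p * fden q).
Proof. by []. Qed.
Lemma frac_scaleE c p :
  (fnum (frac_scale c p) = c *: fnum p) * (fden (frac_scale c p) = fden p).
Proof. by []. Qed.
Let fracE := (frac0E, frac1E, frac_oppE, frac_addE, frac_mulE, frac_scaleE).

Local Opaque frac0 frac1 frac_opp frac_add frac_mul frac_scale fnum fden.

Definition loc_opp (x : localization) := loc_class (frac_opp (repr x)).
Definition loc_add (x y : localization) :=
  loc_class (frac_add (repr x) (repr y)).
Definition loc_mul (x y : localization) :=
  loc_class (frac_mul (repr x) (repr y)).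
Definition loc_scale (c : K) (x : localization) :=
  loc_class (frac_scale c (repr x)).

Let reprE p :
  exists2 u, u \in S & u * (fnum (repr (loc_class p)) * fden p
                            - fnum p * fden (repr (loc_class p))) = 0.
Proof. by apply/loc_classP; rewrite /loc_class reprK. Qed.

Lemma loc_oppE p : loc_opp (loc_class p) = loc_class (frac_opp p).
Proof.
have [u Su E] := reprE p; apply/loc_classP; exists u => //.
by rewrite !fracE !mulNr -opprD mulrN E oppr0.
Qed.

Lemma loc_addE p q :
  loc_add (loc_class p) (loc_class q) = loc_class (frac_add p q).
Proof.
have [u Su E] := reprE p; have [v Sv F] := reprE q.
apply/loc_classP; exists (u * v); first by rewrite rpredM.
move: (repr (loc_class p)) (repr (loc_class q)) E F => p' q' E F.
rewrite !fracE.
rewrite (_ : _ * _ = v * fden q * fden q' * (u * (fnum p' * fden p - fnum p * fden p'))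
  + u * fden p * fden p' * (v * (fnum q' * fden q - fnum q * fden q'))); last by ring.
by rewrite E F !mulr0 addr0.
Qed.

Lemma loc_mulE p q :
  loc_mul (loc_class p) (loc_class q) = loc_class (frac_mul p q).
Proof.
have [u Su E] := reprE p; have [v Sv F] := reprE q.
apply/loc_classP; exists (u * v); first by rewrite rpredM.
move: (repr (loc_class p)) (repr (loc_class q)) E F => p' q' E F.
rewrite !fracE.
rewrite (_ : _ * _ = v * fnum q' * fden q * (u * (fnum p' * fden p - fnum p * fden p'))
  + u * fnum p * fden p' * (v * (fnum q' * fden q - fnum q * fden q'))); last by ring.
by rewrite E F !mulr0 addr0.
Qed.

Lemma loc_scaleE c p :
  loc_scale c (loc_class p) = loc_class (frac_scale c p).
Proof.
have [u Su E] := reprE p; apply/loc_classP; exists u => //.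
by rewrite !fracE -!scalerAl -scalerBr -scalerAr E scaler0.
Qed.

Local Opaque loc_opp loc_add loc_mul loc_scale.
Let locE := (loc_oppE, loc_addE, loc_mulE, loc_scaleE).

Let eq_frac p q :
  fnum p * fden q = fnum q * fden p -> loc_class p = loc_class q.
Proof.
by move=> E; apply/loc_classP; exists 1; rewrite ?rpred1// E subrr mulr0.
Qed.

Let addA : associative loc_add.
Proof.
elim/loc_ind=> p; elim/loc_ind=> q; elim/loc_ind=> r; rewrite !locE.
by apply: eq_frac; rewrite !fracE; ring.
Qed.

Let addC : commutative loc_add.
Proof.
elim/loc_ind=> p; elim/loc_ind=> q; rewrite !locE.
by apply: eq_frac; rewrite !fracE; ring.
Qed.

Let add0 : left_id (loc_class frac0) loc_add.
Proof.
by elim/loc_ind=> p; rewrite !locE; apply: eq_frac; rewrite !fracE; ring.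
Qed.

Let addN : left_inverse (loc_class frac0) loc_opp loc_add.
Proof.
by elim/loc_ind=> p; rewrite !locE; apply: eq_frac; rewrite !fracE; ring.
Qed.

HB.instance Definition _ :=
  GRing.isZmodule.Build localization addA addC add0 addN.

Let mulA : associative loc_mul.
Proof.
elim/loc_ind=> p; elim/loc_ind=> q; elim/loc_ind=> r; rewrite !locE.
by apply: eq_frac; rewrite !fracE; ring.
Qed.

Let mulC : commutative loc_mul.
Proof.
elim/loc_ind=> p; elim/loc_ind=> q; rewrite !locE.
by apply: eq_frac; rewrite !fracE; ring.
Qed.

Let mul1 : left_id (loc_class frac1) loc_mul.
Proof.
by elim/loc_ind=> p; rewrite !locE; apply: eq_frac; rewrite !fracE; ring.
Qed.

Let mulDl : left_distributive loc_mul loc_add.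
Proof.
elim/loc_ind=> p; elim/loc_ind=> q; elim/loc_ind=> r; rewrite !locE.
by apply: eq_frac; rewrite !fracE; ring.
Qed.

(* This is the zero ring when 0 \in S. *)
HB.instance Definition _ :=
  GRing.Zmodule_isComPzRing.Build localization mulA mulC mul1 mulDl.

Let scaleA a b v : loc_scale a (loc_scale b v) = loc_scale (a * b) v.
Proof.
elim/loc_ind: v => p; rewrite !locE; apply: eq_frac.
by rewrite !fracE scalerA.
Qed.

Let scale1 : left_id 1 loc_scale.
Proof.
by elim/loc_ind=> p; rewrite !locE; apply: eq_frac; rewrite !fracE scale1r.
Qed.

Let scaleDr : right_distributive loc_scale loc_add.
Proof.
move=> c; elim/loc_ind=> p; elim/loc_ind=> q; rewrite !locE; apply: eq_frac.
by rewrite !fracE scalerDr !scalerAl.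
Qed.

Let scaleDl v : {morph loc_scale^~ v : a b / a + b >-> loc_add a b}.
Proof.
move=> a b; elim/loc_ind: v => p; rewrite !locE; apply: eq_frac.
by rewrite !fracE scalerDl; ring.
Qed.

HB.instance Definition _ := GRing.Zmodule_isLmodule.Build K localization
  scaleA scale1 scaleDr scaleDl.

End Localization.

(* The F_j generate an ideal, proper as soon as they have a common zero. *)
Section LocalAlgebra.
Variables (K : fieldType) (n r : nat) (F : 'I_r -> {mpoly K[n]}).
Variable a : 'I_n -> K.

Definition is_solution : Prop := forall j, (F j).@[a] = 0.

Definition sys_ideal (sol : is_solution) : {pred {mpoly K[n]}} :=
  fun p => `[< exists g : 'I_r -> {mpoly K[n]}, p = \sum_j g j * F j >].

Variable sol : is_solution.

Lemma sys_ideal_closed : idealr_closed (sys_ideal sol).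
Proof.
split.
- apply/asboolP; exists (fun=> 0); rewrite big1 // => j _; exact: mul0r.
- apply/negP => /asboolP[g /(congr1 (meval a))].
  rewrite meval1 raddf_sum big1 => [/eqP|j _]; first by rewrite oner_eq0.
  by rewrite /= mevalM sol mulr0.
- move=> h _ _ /asboolP[g ->] /asboolP[k ->]; apply/asboolP.
  exists (fun j => h * g j + k j); rewrite mulr_sumr -big_split /=.
  by apply: eq_bigr => j _; rewrite mulrDl mulrA.
Qed.

HB.instance Definition _ :=
  isIdealr.Build {mpoly K[n]} (sys_ideal sol) sys_ideal_closed.

Definition quot_alg : comAlgType K := {ideal_quot (sys_ideal sol)}.

(* The complement of the maximal ideal of the point a in the quotient. *)
Definition nonvanishing : {pred quot_alg} :=
  fun y => `[< exists2 p : {mpoly K[n]}, p.@[a] != 0 & y = \pi_quot_alg p >].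

Lemma nonvanishing_closed : mulr_closed nonvanishing.
Proof.
split; first by apply/asboolP; exists 1; rewrite ?meval1 ?oner_eq0 ?rmorph1.
move=> _ _ /asboolP[p p0 ->] /asboolP[q q0 ->]; apply/asboolP.
by exists (p * q); rewrite ?rmorphM ?mulf_neq0.
Qed.

HB.instance Definition _ :=
  GRing.isMulClosed.Build quot_alg nonvanishing nonvanishing_closed.

Definition local_alg : Type := localization nonvanishing.
HB.instance Definition _ := GRing.ComPzRing.on local_alg.
HB.instance Definition _ := GRing.Lmodule.on local_alg.

End LocalAlgebra.

(* V has dimension d over K: V is linearly isomorphic to K^d. *)
Definition has_dim (K : fieldType) (V : lmodType K) (d : nat) : Prop :=
  inhabited (Vector.axiom d V).


Section Multiplicity.
Variables (R : realType) (n : nat) (F : 'I_n -> {mpoly R[i][n]}).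

(* R[i]^o carries the topology of the norm of R[i]. *)
Definition solution_set : set 'rV[R[i]^o]_n := [set x | is_solution F (x 0)].

Definition has_multiplicity (a : 'rV[R[i]^o]_n) (mu : nat) : Prop :=
  isolated solution_set a
  /\ exists sol : is_solution F (a 0), has_dim (local_alg sol) mu.

End Multiplicity.

(* Variables are indexed from 0: 'X_i stands for x_{i+1}, with exponent
   k ^ i.+1. *)
Definition f_poly (R : realType) (d n : nat) : {mpoly R[i][n]} :=
  \sum_(k < d.+1) ((-1) ^+ k * 'C(d, k)%:R) *:
    \prod_(i < n) 'X_i ^+ (k ^ i.+1)%N.

(* The polynomials f_{m+1,n}, ..., f_{m+n,n}. *)
Definition f_system (R : realType) (m n : nat) (j : 'I_n) : {mpoly R[i][n]} :=
  f_poly R (m + j.+1)%N n.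

(* Main.v *)
Require Import Defs.
From HB Require Import structures.
From mathcomp Require Import boolp classical_sets reals topology complex.
From mathcomp Require normedtype.
From mathcomp Require Import all_boot all_order all_algebra.
From mathcomp Require Import generic_quotient ring_quotient mpoly ring zify.

(** Put x_i = 1 + y_i and give y_i the weight i.  The coefficient of y^a in
    f_d is the alternating sum over k of (-1)^k binom(d, k) q(k), where
    q(k) = prod_i binom(k^i, a_i) is a polynomial in k of degree wt(a) with
    leading coefficient 1 / prod_i a_i!.  A d-th finite difference kills the
    polynomials of degree less than d and reads off the leading coefficient in
    degree d.  Hence, up to the factor (-1)^d d!, the polynomial f_d starts in
    weight d with the form

      h_d(y) = sum of y^a / a! over wt(a) = d
             = coefficient of t^d in exp(y_1 t + ... + y_n t^n)

    (mcoeff_scaled_difference), and these forms satisfy the recurrence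
    d h_d = sum_i i y_i h_(d-i) (scaled_difference_rec).

    Isolatedness and finite dimension.  If h_(m+1), ..., h_(m+n) vanish at y,
    then the recurrence makes all later h_d vanish, so E = exp(P), with
    P = sum_i y_i t^i, is a polynomial with E' = P' E; comparing degrees,
    P = 0 and so y = 0.  The same comparison of coefficients, carried out in
    the ring, shows that every y_i is nilpotent modulo the initial forms of the
    ideal I of the system (initial_rad_var).  So polynomials of large order lie
    in I up to terms of arbitrarily high order (initial_approx), and Nakayama's
    lemma gives u with u(1) <> 0 and an exponent e such that u multiplies all
    of the e-th power of the maximal ideal of 1 into I (local_nakayama).
    Where u does not vanish, the only solution is 1; and monomials in x - 1 of
    degree less than e span the local algebra.

    The lower bound.  Let mu be the dimension of the local algebra, b_k a basis
    given by polynomials, and g_1, ..., g_n the system, of orders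
    d_j = m + j.  Writing a polynomial as a combination of the b_k plus an
    element of I, and repeating this with the coefficients of the g_j, one sees
    that modulo order greater than N everything is a combination of the
    products b_k g^alpha with sum_j d_j alpha_j <= N.  Comparing dimensions
    (simplex_le_spanning),

      #{a : sum_i i a_i <= N} <= mu #{alpha : sum_j d_j alpha_j <= N}.

    The left side grows like N^n / (n! prod_i i) and the right side like
    mu N^n / (n! prod_j d_j), so mu >= prod_j (m + j) / n! = binom(n + m, n)
    (simplex_count_bound). *)

Set Implicit Arguments.
Unset Strict Implicit.
Unset Printing Implicit Defensive.

Import Order.TTheory GRing.Theory Num.Theory.

(** * Counting lattice points of weighted simplices *)

Section Count.
Variable n : nat.
Implicit Types (w d : 'I_n -> nat) (N M : nat).

Definition simplex w N := [set a : {ffun 'I_n -> 'I_N.+1} | \sum_i w i * a i <= N].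

Definition box w M := [set r : {ffun 'I_n -> 'I_M.+1} | [forall i, r i < w i]].

Lemma card_ord_lt k M : k <= M.+1 -> #|[pred r : 'I_M.+1 | r < k]| = k.
Proof.
move=> le_k; rewrite -sum1_card -[RHS]card_ord -sum1_card.
by rewrite (big_ord_widen _ (fun=> 1) le_k).
Qed.

Lemma card_box w M : (forall i, w i <= M.+1) -> #|box w M| = \prod_i w i.
Proof.
move=> le_w; pose F (i : 'I_n) := [pred r : 'I_M.+1 | r < w i].
have -> : #|box w M| = #|(family F : simpl_pred {ffun 'I_n -> 'I_M.+1})|.
  by apply: eq_card => r; rewrite !inE; apply: eq_forallb => i; rewrite inE.
rewrite card_family foldrE big_map big_enum /=; apply: eq_bigr => i _.
exact: card_ord_lt.
Qed.

Lemma leq_term (f : 'I_n -> nat) i : f i <= \sum_j f j.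
Proof. by rewrite (bigD1 i) //= leq_addr. Qed.

(** Dividing every coordinate b_i by w_i sends the standard simplex to the
    weighted one, and a quotient together with the remainders (a point of a box
    of size prod_i w_i) determines b. *)
Lemma card_simplex1_le w N : (forall i, 0 < w i) ->
  #|simplex (fun=> 1) N| <= (\prod_i w i) * #|simplex w N|.
Proof.
move=> w0; pose M := \sum_i w i.
have le_w i : w i <= M.+1 by apply: leq_trans (leqnSn _); apply: leq_term.
rewrite -(card_box le_w) -cardsX.
pose f (b : {ffun 'I_n -> 'I_N.+1}) :=
  ([ffun i => inord (b i %% w i)] : {ffun 'I_n -> 'I_M.+1},
   [ffun i => inord (b i %/ w i)] : {ffun 'I_n -> 'I_N.+1}).
have modE (b : {ffun 'I_n -> 'I_N.+1}) i :
    (inord (b i %% w i) : 'I_M.+1) = b i %% w i :> nat.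
  by rewrite inordK //; apply: leq_trans (le_w i); rewrite ltn_mod.
have divE (b : {ffun 'I_n -> 'I_N.+1}) i :
    (inord (b i %/ w i) : 'I_N.+1) = b i %/ w i :> nat.
  by rewrite inordK //; apply: leq_ltn_trans (leq_div _ _) (ltn_ord _).
have inj_f : injective f.
  move=> b c [/ffunP eq_mod /ffunP eq_div]; apply/ffunP => i; apply: val_inj => /=.
  rewrite (divn_eq (b i) (w i)) (divn_eq (c i) (w i)).
  have := congr1 val (eq_mod i); have := congr1 val (eq_div i).
  by rewrite !ffunE /= !modE !divE => -> ->.
rewrite -(card_imset _ inj_f); apply/subset_leq_card/subsetP => _ /imsetP[b + ->].
rewrite !inE /= => le_b; apply/andP; split.
  by apply/forallP => i; rewrite ffunE modE ltn_mod.
apply: leq_trans le_b; apply: leq_sum => i _.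
by rewrite ffunE divE mul1n mulnC leq_trunc_div.
Qed.

(** The boxes of side lengths d_i based at the points d_i a_i, for a in the
    weighted simplex, are disjoint and stay in a slightly larger standard
    simplex. *)
Lemma prod_card_simplex_le d N : (forall i, 0 < d i) ->
  (\prod_i d i) * #|simplex d N| <= #|simplex (fun=> 1) (N + \sum_i d i)|.
Proof.
move=> d0; pose M := \sum_i d i.
have le_d i : d i <= M.+1 by apply: leq_trans (leqnSn _); apply: leq_term.
rewrite -(card_box le_d) -cardsX.
pose f (x : {ffun 'I_n -> 'I_M.+1} * {ffun 'I_n -> 'I_N.+1}) :=
  [ffun i => inord (x.2 i * d i + x.1 i)] : {ffun 'I_n -> 'I_(N + M).+1}.
have fE x : x \in setX (box d M) (simplex d N) ->
    forall i, f x i = x.2 i * d i + x.1 i :> nat.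
  case: x => r a; rewrite !inE /= => /andP[/forallP hr ha] i.
  rewrite ffunE inordK //= ltnS leq_add //.
    by apply: leq_trans ha; rewrite mulnC; apply: (leq_term (fun j => d j * a j)).
  by apply: leq_trans (ltnW (hr i)) (leq_term _ _).
have inj_f : {in setX (box d M) (simplex d N) &, injective f}.
  move=> [r a] [s b] hx hy eq_f.
  have eqf i := congr1 val (congr1 (fun g : {ffun _} => g i) eq_f).
  have {eqf} eqf i : a i * d i + r i = b i * d i + s i.
    by have := eqf i; rewrite /= (fE _ hx) (fE _ hy).
  move: hx hy; rewrite !inE /= => /andP[/forallP hr _] /andP[/forallP hs _].
  congr pair; apply/ffunP => i; apply: val_inj => /=.
    have := congr1 (modn^~ (d i)) (eqf i).
    by rewrite /= !modnMDl !modn_small.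
  have := congr1 (divn^~ (d i)) (eqf i).
  by rewrite /= !divnMDl // !divn_small // !addn0.
rewrite -(card_in_imset inj_f); apply/subset_leq_card/subsetP => _ /imsetP[x hx ->].
rewrite inE.
under eq_bigr => i _ do rewrite mul1n (fE _ hx) mulnC.
rewrite big_split /=; move: hx; rewrite !inE => /andP[/forallP hr ha].
by apply: leq_add => //; apply: leq_sum => i _; apply: ltnW.
Qed.

Lemma card_simplex1 N : #|simplex (fun=> 1) N| = 'C(n + N, n).
Proof.
rewrite -card_partial_ord_partitions.
pose f (t : n.-tuple 'I_N.+1) : {ffun 'I_n -> 'I_N.+1} := [ffun i => tnth t i].
have inj_f : injective f.
  by move=> t u /ffunP h; apply: eq_from_tnth => i; have := h i; rewrite !ffunE.
rewrite -(card_imset _ inj_f); apply: eq_card => a; rewrite !inE.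
under eq_bigr => i _ do rewrite mul1n.
apply/idP/imsetP => [ha|[t + ->]].
  exists [tuple a i | i < n]; last by apply/ffunP => i; rewrite ffunE tnth_mktuple.
  by rewrite inE big_tuple; under eq_bigr => i _ do rewrite tnth_mktuple.
by rewrite inE big_tuple (eq_bigr (fun i => val (f t i))) // => i _; rewrite ffunE.
Qed.
End Count.

Lemma leq_pow_add X c n :
  0 < n -> 0 < X -> (X + c) ^ n <= X ^ n + ((1 + c) ^ n - 1) * X ^ n.-1.
Proof.
case: n => // n _ X0; elim: n => [|n IHn].
  by rewrite !expn1 expn0 muln1; lia.
rewrite [(X + c) ^ _]expnSr /=.
apply: leq_trans (_ : (X ^ n.+1 + ((1 + c) ^ n.+1 - 1) * X ^ n) * (X + c) <= _).
  by rewrite leq_mul2r IHn orbT.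
have k1 : 0 < (1 + c) ^ n.+1 by rewrite expn_gt0.
have kE : (1 + c) ^ n.+2 = (1 + c) * (1 + c) ^ n.+1 by rewrite expnS.
move: (_ ^ n.+1) k1 kE => k k1 ->; rewrite !expnS.
case: k k1 => // k _; move: (X ^ n) => Y; rewrite subn1 /=.
have -> : (1 + c) * k.+1 - 1 = c + k + k * c by rewrite mulnS; lia.
have : k * c * Y <= X * (k * c * Y) by rewrite leq_pmull.
by nia.
Qed.

(** The leading coefficients of two polynomials in X of degree n compare as the
    polynomials do for large X; the shift by c only affects lower terms. *)
Lemma leq_of_pow_growth n D V c : 0 < n ->
  (forall X, 0 < X -> D * X ^ n <= V * (X + c) ^ n) -> D <= V.
Proof.
move=> n0 h; rewrite leqNgt; apply/negP => lt_VD.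
(* By leq_pow_add the shift costs at most k X^(n-1), which one extra X^n
   absorbs once X > V k. *)
pose k := (1 + c) ^ n - 1; pose X := (V * k).+1.
have := h X isT; apply/negP; rewrite -ltnNge.
apply: leq_ltn_trans (_ : V * (X ^ n + k * X ^ n.-1) < _).
  by rewrite leq_mul2l leq_pow_add ?orbT.
have E : X ^ n = X * X ^ n.-1 by rewrite -expnS prednK.
have X0 : 0 < X ^ n.-1 by rewrite expn_gt0.
apply: leq_trans (_ : V.+1 * X ^ n <= _); last by rewrite leq_mul2r lt_VD orbT.
rewrite mulnDr mulSn addnC ltn_add2r mulnA E ltn_pmul2r //.
Qed.

Lemma leq_pow_ffact a n : (a.+1) ^ n <= (n + a) ^_ n <= (n + a) ^ n.
Proof.
elim: n => [|n /andP[IH1 IH2]]; first by rewrite !expn0 ffactn0.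
rewrite expnS addSn ffactSS expnS; apply/andP; split.
  by apply: leq_mul => //; rewrite ltnS leq_addl.
rewrite leq_mul //; apply: leq_trans IH2 _.
by have [->|n0] := posnP n; rewrite ?expn0 // leq_exp2r.
Qed.

(** Both simplices are compared with the standard one, whose cardinal is a
    binomial coefficient, hence a polynomial of degree n in N: the two counts
    have densities 1 / prod w and 1 / prod d. *)
Lemma simplex_count_bound n (w d : 'I_n -> nat) mu : 0 < n ->
  (forall i, 0 < w i) -> (forall i, 0 < d i) ->
  (forall N, #|simplex w N| <= mu * #|simplex d N|) ->
  \prod_i d i <= (\prod_i w i) * mu.
Proof.
move=> n0 w0 d0 h; set D := \prod_i d i; set W := \prod_i w i.
pose s := \sum_i d i.
apply: (leq_of_pow_growth (c := n + s) n0) => -[//|N] _.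
have := leq_trans (card_simplex1_le N w0)
  (leq_mul (leqnn W) (h N)).
rewrite -/W => h1.
have h2 : D * 'C(n + N, n) <= W * mu * 'C(n + (N + s), n).
  rewrite -!card_simplex1.
  apply: leq_trans (_ : D * (W * (mu * #|simplex d N|)) <= _).
    by rewrite leq_mul2l h1 orbT.
  rewrite !mulnA -[D * W * mu]mulnA [D * _]mulnC -mulnA.
  by rewrite leq_mul2l prod_card_simplex_le ?orbT.
have /andP[l1 _] := leq_pow_ffact N n.
have /andP[_ l2] := leq_pow_ffact (N + s) n.
apply: leq_trans (_ : D * (n + N) ^_ n <= _); first by rewrite leq_mul2l l1 orbT.
apply: leq_trans (_ : W * mu * (n + (N + s)) ^_ n <= _).
  by rewrite -!bin_ffact !mulnA leq_mul2r h2 orbT.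
rewrite leq_mul2l; apply/orP; right; apply: leq_trans l2 _.
by rewrite leq_exp2r //; lia.
Qed.

Local Open Scope ring_scope.

(** * Order of vanishing *)

Section Order.
Variables (K : fieldType) (n : nat).
Implicit Types (p q : {mpoly K[n]}) (v w : nat).

(** Used with the total degree and with the weight sum_i (i + 1) a_i, as order
    of vanishing at the origin. *)
Definition ord_ge (mf : 'X_{1..n} -> nat) w p : Prop :=
  forall a, (mf a < w)%N -> p@_a = 0.

Section Weight.
Variable mf : 'X_{1..n} -> nat.

Lemma ord_geP w p :
  ord_ge mf w p <-> {in msupp p, forall a, (w <= mf a)%N}.
Proof.
split=> [H a|H a lt_aw]; last first.
  by apply: memN_msupp_eq0; apply/negP=> /H; rewrite leqNgt lt_aw.
by apply: contraTT; rewrite -ltnNge => /H pa0; rewrite mcoeff_msupp pa0 eqxx.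
Qed.

Lemma ord_ge0 w : ord_ge mf w 0.
Proof. by move=> a _; rewrite mcoeff0. Qed.

Lemma ord_geD w p q : ord_ge mf w p -> ord_ge mf w q -> ord_ge mf w (p + q).
Proof. by move=> hp hq a lt_aw; rewrite mcoeffD hp ?hq ?addr0. Qed.

Lemma ord_geZ w c p : ord_ge mf w p -> ord_ge mf w (c *: p).
Proof. by move=> hp a lt_aw; rewrite mcoeffZ hp ?mulr0. Qed.

Lemma ord_geW v w p : (v <= w)%N -> ord_ge mf w p -> ord_ge mf v p.
Proof. by move=> le_vw hp a lt_av; apply: hp; apply: leq_trans le_vw. Qed.

Lemma ord_geX a : ord_ge mf (mf a) 'X_[a].
Proof. by move=> b lt_ba; rewrite mcoeffX; case: eqP lt_ba => // ->; rewrite ltnn. Qed.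

End Weight.

Section Measure.
Variable mf : measure n.

Lemma ord_geM v w p q : ord_ge mf v p -> ord_ge mf w q -> ord_ge mf (v + w) (p * q).
Proof.
move=> hp hq a lt_a; rewrite mcoeffM big1 // => k /eqP ak.
case: (ltnP (mf (val k.1)) v) => [/hp->|le_v]; first by rewrite mul0r.
rewrite hq ?mulr0 //; move/(congr1 mf): ak; rewrite mfD => ak.
by rewrite -(ltn_add2l v); apply: leq_ltn_trans lt_a; rewrite ak leq_add2r.
Qed.

Lemma ord_geMr w p q : ord_ge mf w q -> ord_ge mf w (p * q).
Proof. by move=> hq; rewrite -[w]add0n; apply: ord_geM. Qed.

Lemma ord_geMn v p k : ord_ge mf v p -> ord_ge mf (v * k) (p ^+ k).
Proof.
move=> hp; elim: k => [|k IHk]; first by rewrite muln0.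
by rewrite mulnS exprS; apply: ord_geM.
Qed.

End Measure.
End Order.

(** * Initial forms of an ideal *)

Lemma mnmwgtMn n (a : 'X_{1..n}) k : mnmwgt (a *+ k)%MM = (mnmwgt a * k)%N.
Proof.
rewrite /mnmwgt big_distrl; apply: eq_bigr => i _.
by rewrite mulmnE mulnAC.
Qed.

Lemma mdeg_le_wgt n (a : 'X_{1..n}) : (mdeg a <= mnmwgt a)%N.
Proof. by rewrite mdegE; apply: leq_sum => i _; rewrite leq_pmulr. Qed.

Lemma wgt_le_mdeg n (a : 'X_{1..n}) : (mnmwgt a <= n * mdeg a)%N.
Proof.
rewrite mdegE big_distrr /=; apply: leq_sum => i _.
by rewrite mulnC leq_mul2r ltn_ord orbT.
Qed.

Notation wt_ge := (ord_ge (@mnmwgt _)).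

Definition is_ideal (A : comNzRingType) (I : A -> Prop) : Prop :=
  [/\ I 0, forall p q, I p -> I q -> I (p + q) & forall r p, I p -> I (r * p)].

Section InitialForms.
Variables (K : numFieldType) (n : nat) (I : {mpoly K[n]} -> Prop).
Hypothesis idI : is_ideal I.
Implicit Types (p q r : {mpoly K[n]}) (v w : nat).

Let I0 : I 0. Proof. by case: idI. Qed.
Let ID p q : I p -> I q -> I (p + q). Proof. by case: idI => _ + _; apply. Qed.
Let IM r p : I p -> I (r * p). Proof. by case: idI => _ _; apply. Qed.
Let IZ c p : I p -> I (c *: p).
Proof. by rewrite -mul_mpolyC; apply: IM. Qed.

(** The part of order w of p is the part of order w of an element of I of order
    at least w; that is, it belongs to the degree w component of the ideal of
    initial forms of I. *)
Definition initial w p : Prop :=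
  exists q, [/\ I q, wt_ge w q & wt_ge w.+1 (p - q)].

Lemma initial_ge w p : initial w p -> wt_ge w p.
Proof.
case=> q [_ hq hpq]; rewrite -(subrK q p); apply: ord_geD => //.
exact: ord_geW hpq.
Qed.

Lemma initial_higher w p : wt_ge w.+1 p -> initial w p.
Proof. by exists 0; split; [exact: I0|exact: ord_ge0|rewrite subr0]. Qed.

Lemma initial_ideal w p : I p -> wt_ge w p -> initial w p.
Proof. by exists p; split=> //; rewrite subrr; apply: ord_ge0. Qed.

Lemma initialD w p q : initial w p -> initial w q -> initial w (p + q).
Proof.
move=> [p' [Ip hp hp']] [q' [Iq hq hq']]; exists (p' + q').
by split; [exact: ID|exact: ord_geD|rewrite opprD addrACA; apply: ord_geD].
Qed.

Lemma initial_sum w (J : Type) (r : seq J) (P : pred J) (f : J -> {mpoly K[n]}) :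
  (forall j, P j -> initial w (f j)) -> initial w (\sum_(j <- r | P j) f j).
Proof.
move=> hf; elim/big_ind: _ => //; last exact: initialD.
exact/initial_higher/ord_ge0.
Qed.

Lemma initialM v w r p : wt_ge v r -> initial w p -> initial (v + w) (r * p).
Proof.
move=> hr [p' [Ip hp hp']]; exists (r * p').
by split; [exact: IM|exact: ord_geM|rewrite -mulrBr -addnS; apply: ord_geM].
Qed.

Lemma initialZ w c p : initial w p -> initial w (c *: p).
Proof.
move=> [p' [Ip hp hp']]; exists (c *: p').
by split; [exact: IZ|exact: ord_geZ|rewrite -scalerBr; apply: ord_geZ].
Qed.

(** The radical of the ideal of initial forms, in degree w. *)
Definition initial_rad w p : Prop :=
  wt_ge w p /\ exists k, initial (w * k) (p ^+ k).

Lemma initial_rad1 w p : initial w p -> initial_rad w p.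
Proof.
by move=> hp; split; [exact: initial_ge|exists 1%N; rewrite muln1 expr1].
Qed.

Lemma initial_radM v w r p :
  wt_ge v r -> initial_rad w p -> initial_rad (v + w) (r * p).
Proof.
move=> hr [hp [k hk]]; split; first exact: ord_geM.
by exists k; rewrite exprMn mulnDl; apply: initialM => //; apply: ord_geMn.
Qed.

Lemma initial_radZ w c p : initial_rad w p -> initial_rad w (c *: p).
Proof.
move=> [hp [k hk]]; split; first exact: ord_geZ.
by exists k; rewrite exprZn; apply: initialZ.
Qed.

Lemma initial_radD w p q :
  initial_rad w p -> initial_rad w q -> initial_rad w (p + q).
Proof.
move=> [hp [k hk]] [hq [l hl]]; split; first exact: ord_geD.
exists (k + l)%N; rewrite exprDn; apply: initial_sum => i _.
(* In the i-th term of (p + q)^(k + l), either p has exponent at least k or q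
   has exponent at least l. *)
rewrite -scaler_nat; apply: initialZ; case: (leqP i l) => [le_il|lt_li].
  have -> : (k + l - i = (l - i) + k)%N by lia.
  have -> : (w * (k + l) = (w * (l - i) + w * i) + w * k)%N.
    by rewrite -!mulnDr; congr muln; lia.
  rewrite exprD mulrAC; apply: initialM hk.
  by apply: ord_geM; apply: ord_geMn.
have -> : (nat_of_ord i = (i - l) + l)%N by lia.
have -> : (w * (k + l) = (w * (k + l - (i - l + l)) + w * (i - l)) + w * l)%N.
  by rewrite -!mulnDr; congr muln; have := ltn_ord i; lia.
rewrite exprD mulrA; apply: initialM hl.
by apply: ord_geM; apply: ord_geMn.
Qed.

Lemma initial_rad_sum w (J : Type) (r : seq J) (P : pred J)
    (f : J -> {mpoly K[n]}) :
  (forall j, P j -> initial_rad w (f j)) ->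
  initial_rad w (\sum_(j <- r | P j) f j).
Proof.
move=> hf; elim/big_ind: _ => //; last exact: initial_radD.
exact/initial_rad1/initial_higher/ord_ge0.
Qed.

Lemma initial_radX w p k :
  wt_ge w p -> initial_rad (w * k) (p ^+ k) -> initial_rad w p.
Proof.
by move=> hp [_ [l hl]]; split=> //; exists (k * l)%N; rewrite exprM mulnA.
Qed.

Lemma wtXm (a : 'X_{1..n}) : wt_ge (mnmwgt a) ('X_[a] : {mpoly K[n]}).
Proof. exact: ord_geX. Qed.

Lemma wtX (i : 'I_n) : wt_ge i.+1 ('X_i : {mpoly K[n]}).
Proof. by rewrite -(mnmwgt1 i); apply: wtXm. Qed.

(** The initial forms of the G d behave as the coefficients of
    E(t) = exp(sum_i X_i t^i), of which recG expresses E' = P' E, and those with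
    index from m + 1 to m + n are initial forms of I. *)
Variables (m : nat) (G : nat -> {mpoly K[n]}).
Hypothesis G0 : G 0 = 1.
Hypothesis wtG : forall d, wt_ge d (G d).
Hypothesis recG : forall d, wt_ge d.+1
  (d%:R *: G d - \sum_(i < n | (i < d)%N) i.+1%:R *: ('X_i * G (d - i.+1))).
Hypothesis IG : forall d, (m < d <= m + n)%N -> I (G d).

(** Modulo the initial forms of I and the variables of index above i, the series
    E is a polynomial of degree at most m and P has degree i.+1.  Reading
    E' = P' E from the top degree down shows that X_i ^ k kills all coefficients
    of E of index above m - k: once this is known for k, all terms of the
    recurrence at index (m - k) + i.+1 are killed by X_i ^ k, except for
    X_i G_(m - k), which is therefore killed as well. *)
Lemma initial_rad_varX (i : 'I_n) :
  (forall j : 'I_n, (i < j)%N -> initial_rad j.+1 'X_j) ->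
  forall k d, (m < d + k)%N -> (d <= m + n)%N ->
  initial_rad (i.+1 * k + d) ('X_i ^+ k * G d).
Proof.
move=> hi; elim=> [|k IHk] d lt_m le_d.
  rewrite muln0 add0n expr0 mul1r; apply: initial_rad1; apply: initial_ideal => //.
  by apply: IG; rewrite le_d andbT; lia.
case: (ltnP m (d + k)) => [lt_m'|le_m].
  rewrite mulnS -addnA exprS -mulrA; apply: initial_radM; first exact: wtX.
  exact: IHk.
(* Here d = m - k; the recurrence at e = d + i.+1 is solved for X_i G_d. *)
pose e := (d + i.+1)%N.
have lt_n := ltn_ord i.
pose rest := \sum_(j < n | (j < e)%N && (j != i)) j.+1%:R *: ('X_j * G (e - j.+1)).
pose err := e%:R *: G e - \sum_(j < n | (j < e)%N) j.+1%:R *: ('X_j * G (e - j.+1)).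
have E : 'X_i * G d = i.+1%:R^-1 *: (e%:R *: G e + (-1) *: rest + (-1) *: err).
  rewrite /err (bigD1 i) /=; last by rewrite /e; lia.
  have -> : (e - i.+1 = d)%N by rewrite /e; lia.
  rewrite -/rest !scaleN1r.
  set A := e%:R *: _; set x := i.+1%:R *: _.
  have -> : A - rest - (A - (x + rest)) = x by ring.
  by rewrite /x scalerA mulVf ?scale1r // pnatr_eq0.
rewrite exprS [_ * 'X_i ^+ k]mulrC -mulrA E -scalerAr.
have -> : (i.+1 * k.+1 + d = i.+1 * k + e)%N by rewrite /e; lia.
apply: initial_radZ; rewrite !mulrDr; apply: initial_radD; last first.
  rewrite -scalerAr; apply/initial_radZ/initial_rad1/initial_higher.
  rewrite -addnS; apply: ord_geM; last exact: recG.
  by apply: ord_geMn; apply: wtX.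
apply: initial_radD.
  by rewrite -scalerAr; apply/initial_radZ/IHk; rewrite /e; lia.
rewrite -scalerAr; apply/initial_radZ; rewrite mulr_sumr.
apply: initial_rad_sum => j /andP[lt_j ne_ji].
rewrite -scalerAr; apply/initial_radZ.
have ne : nat_of_ord j != i by [].
case: (ltnP i j) => [lt_ij|le_ji].
  rewrite mulrCA [X in initial_rad _ X]mulrC.
  have -> : (i.+1 * k + e = (i.+1 * k + (e - j.+1)) + j.+1)%N by lia.
  apply: initial_radM; last exact: hi.
  by apply: ord_geM => //; apply: ord_geMn; apply: wtX.
have -> : (i.+1 * k + e = j.+1 + (i.+1 * k + (e - j.+1)))%N by lia.
rewrite mulrCA; apply: initial_radM; first exact: wtX.
by apply: IHk; rewrite /e; lia.
Qed.

(** For k = m + 1 even the constant coefficient G 0 = 1 of E is killed by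
    X_i ^ k; the variables are treated from the last one down. *)
Lemma initial_rad_var (i : 'I_n) : initial_rad i.+1 'X_i.
Proof.
have [k] := ubnP (n - i); elim: k i => // k IHk i lt_k.
have hi (j : 'I_n) : (i < j)%N -> initial_rad j.+1 'X_j.
  by move=> lt_ij; apply: IHk; have := ltn_ord j; lia.
apply: (@initial_radX _ _ m.+1); first exact: wtX.
have := initial_rad_varX hi (k := m.+1) (d := 0).
by rewrite G0 mulr1 addn0; apply; lia.
Qed.

(** A monomial of large degree is divisible by a high power of some variable. *)
Lemma initial_monomial :
  exists e, forall a, (e <= mdeg a)%N -> initial (mnmwgt a) 'X_[a].
Proof.
have h (i : 'I_n) : exists k, initial (i.+1 * k) ('X_i ^+ k).
  by case: (initial_rad_var i).
have {h} /fin_all_exists[N hN] := h.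
exists (\sum_i N i).+1 => a; rewrite mdegE => lt_a.
have [i le_i] : exists i, (N i <= a i)%N.
  apply/existsP; rewrite -[[exists _, _]]negbK negb_exists; apply/negP=> /forallP h.
  move: lt_a; rewrite ltnNge => /negP; apply; apply: leq_sum => i _.
  by have := h i; rewrite -ltnNge; apply: ltnW.
have -> : a = ((a - U_(i) *+ N i) + U_(i) *+ N i)%MM.
  apply/mnmP=> j; rewrite mnmDE mnmBE mulmnE mnm1E.
  by case: eqP => [<-|_]; rewrite ?mul1n ?mul0n; lia.
rewrite mpolyXD mnmwgtD; apply: initialM; first exact: wtXm.
rewrite -mpolyXn; have -> // : mnmwgt (U_(i) *+ N i)%MM = (i.+1 * N i)%N.
by rewrite mnmwgtMn mnmwgt1.
Qed.

(** Elements of I are subtracted to remove the lowest order terms one order at a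
    time.  Since weights are at most n times degrees, large weight forces the
    large degree that initial_monomial asks for. *)
Lemma initial_approx : exists w0, forall w w' p, (w0 <= w)%N -> wt_ge w p ->
  exists q, I q /\ wt_ge w' (p - q).
Proof.
have [e he] := initial_monomial; exists (n * e).+1 => w w'.
have step v p : (n * e < v)%N -> wt_ge v p -> initial v p.
  move=> le_v /ord_geP hv; rewrite [p]mpolyE big_seq_cond.
  apply: initial_sum => a /andP[ap _]; apply: initialZ.
  have := hv a ap; rewrite leq_eqVlt => /orP[/eqP Ea|lt_va].
    rewrite Ea; apply: he; rewrite leqNgt; apply/negP => lt_ae.
    move: le_v; rewrite leqNgt => /negP; apply; rewrite Ea.
    by apply: leq_trans (wgt_le_mdeg a) _; rewrite leq_mul2l ltnW ?orbT.
  by apply/initial_higher/(ord_geW lt_va); exact: wtXm.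
have [k] := ubnP (w' - w); elim: k w => // k IHk w lt_k p le_w hp.
case: (leqP w' w) => [le_w'|lt_w].
  by exists 0; rewrite subr0; split; [exact: I0|exact: ord_geW hp].
have [q [Iq _ hq]] := step w p le_w hp.
have [||r [Ir hr]] := IHk w.+1 _ (p - q) _ hq; [lia|lia|].
exists (q + r); split; first exact: ID.
by rewrite opprD addrA.
Qed.

End InitialForms.

(** * Nakayama's lemma at the origin *)

Notation deg_ge := (ord_ge (@mdeg _)).

Lemma ideal_sum (A : comNzRingType) (I : A -> Prop) (J : Type) (r : seq J)
    (P : pred J) (f : J -> A) :
  is_ideal I -> (forall j, P j -> I (f j)) -> I (\sum_(j <- r | P j) f j).
Proof. by case=> I0 ID _ hf; elim/big_ind: _. Qed.

(** Cramer's rule: \det M * q = \adj M *m (M *m q). *)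
Lemma ideal_det_trick (A : comNzRingType) (I : A -> Prop) k
    (M : 'M[A]_k) (q : 'cV[A]_k) :
  is_ideal I -> (forall i, I ((M *m q) i 0)) -> forall i, I (\det M * q i 0).
Proof.
move=> idI hq i.
have -> : \det M * q i 0 = (\adj M *m (M *m q)) i 0.
  by rewrite mulmxA mul_adj_mx mul_scalar_mx mxE.
rewrite mxE; apply: ideal_sum => // j _.
by case: idI => _ _ IM; apply: IM.
Qed.

Section Nakayama.
Variables (K : fieldType) (n : nat).
Implicit Types (p q r : {mpoly K[n]}).

Lemma mnm_subUK (a : 'X_{1..n}) i : (0 < a i)%N -> (a - U_(i) + U_(i))%MM = a.
Proof.
move=> ai; apply: submK; apply/mnm_lepP => j; rewrite mnm1E.
by case: eqP => // <-.
Qed.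

Lemma mdeg_gt0P (a : 'X_{1..n}) : (0 < mdeg a)%N -> exists i, (0 < a i)%N.
Proof.
rewrite lt0n mdeg_eq0 => a0; apply/existsP; apply: contraNT a0.
rewrite negb_exists => /forallP h; apply/eqP/mnmP => i; rewrite mnm0E.
by apply/eqP; rewrite -leqn0 leqNgt.
Qed.

Lemma meval_0 p : p.@[fun=> 0] = p@_0%MM.
Proof.
rewrite [in LHS](mpolyE p) [in RHS](mpolyE p) !raddf_sum /=.
apply: eq_bigr => a _; rewrite mevalZ mevalX mcoeffZ mcoeffX; congr (_ * _).
have [->|] := eqVneq a 0%MM.
  by rewrite big1 // => i _; rewrite mnm0E expr0.
rewrite -mdeg_eq0 -lt0n => /mdeg_gt0P[i ai].
by rewrite (bigD1 i) //= expr0n eqn0Ngt ai mul0r.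
Qed.

Lemma deg_ge1 p : p.@[fun=> 0] = 0 -> deg_ge 1 p.
Proof.
by rewrite meval_0 => p0 a; rewrite ltnS leqn0 mdeg_eq0 => /eqP->.
Qed.

Lemma mdeg_split e (a : 'X_{1..n}) :
  (e <= mdeg a)%N -> exists2 b, (b <= a)%MM & mdeg b = e.
Proof.
have [k] := ubnP (mdeg a - e); elim: k a => // k IHk a lt_k.
rewrite leq_eqVlt => /orP[/eqP->|lt_ea]; first by exists a => //; apply/mnm_lepP.
have [|i ai] := mdeg_gt0P (a := a); first by lia.
have Da : mdeg a = (mdeg (a - U_(i))%MM).+1.
  by rewrite -{1}(mnm_subUK ai) mdegD mdeg1 addn1.
have [||b le_b Db] := IHk (a - U_(i))%MM; [by lia|by lia|exists b => //].
by apply: lepm_trans le_b _; apply: lem_subr.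
Qed.

Lemma deg_ge_split v e p : deg_ge (v + e) p ->
  exists r : 'X_{1..n < e.+1} -> {mpoly K[n]}, (forall b, deg_ge v (r b)) /\
    p = \sum_(b : 'X_{1..n < e.+1} | mdeg b == e) r b * 'X_[b].
Proof.
move=> /ord_geP hp; rewrite [p]mpolyE big_seq.
elim/big_ind: _ => [|_ _ [r [hr ->]] [s [hs ->]]|a ap].
- exists (fun=> 0); split=> [b|]; first exact: ord_ge0.
  by rewrite big1 // => b _; rewrite mul0r.
- exists (fun b => r b + s b); split=> [b|]; first exact: ord_geD.
  by rewrite -big_split; apply: eq_bigr => b _; rewrite mulrDl.
have le_a := hp a ap.
have [|b le_ba Db] := @mdeg_split e a; first by lia.
have lt_b : (mdeg b < e.+1)%N by rewrite Db.
exists (fun c => if c == BMultinom lt_b then p@_a *: 'X_[a - b] else 0).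
split=> [c|].
  case: eqP => _; last exact: ord_ge0.
  apply: ord_geZ; apply: (@ord_geW _ _ _ _ (mdeg (a - b)%MM)).
    by move: le_a; rewrite -{1}(submK le_ba) mdegD; lia.
  exact: ord_geX.
rewrite (bigD1 (BMultinom lt_b)) /= ?Db ?eqxx // big1 => [|c /andP[_ /negbTE->]].
  by rewrite addr0 -scalerAl -mpolyXD submK.
by rewrite mul0r.
Qed.

(** If q is the vector of the monomials of degree e, the hypothesis reads
    (1 - R) q = 0 modulo I, with R a matrix vanishing at the origin; then
    u = \det (1 - R) works. *)
Lemma nakayama (I : {mpoly K[n]} -> Prop) e : is_ideal I ->
  (forall p, deg_ge e p -> exists q, I q /\ deg_ge e.+1 (p - q)) ->
  exists u, u.@[fun=> 0] = 1 /\ forall p, deg_ge e p -> I (u * p).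
Proof.
move=> idI hI; have [I0 ID IM] := idI.
pose T := 'X_{1..n < e.+1}.
have /fin_all_exists[r hr] : forall a : T, exists r : T -> {mpoly K[n]},
    (forall b, (r b).@[fun=> 0] = 0) /\
    (mdeg a = e -> I ('X_[a] - \sum_(b : T | mdeg b == e) r b * 'X_[b])).
  move=> a; have [Da|Da] := eqVneq (mdeg a) e; last first.
    exists (fun=> 0); split=> [b|/eqP]; first exact: meval0.
    by rewrite (negbTE Da).
  have [|q [Iq hq]] := hI 'X_[a].
    by move=> b; rewrite -[X in (_ < X)%N]Da; apply: ord_geX.
  have [r [hr E]] := deg_ge_split (v := 1) hq.
  exists r; split=> [b|_]; first by rewrite meval_0 hr // mdeg0.
  by rewrite -E opprB addrC subrK.
(* The matrix is indexed by all monomials of degree at most e, with zero rows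
   and zero entries of q for those of degree less than e. *)
pose k := #|{: 'X_{1..n < e.+1}}|.
pose x (i : 'I_k) : T := enum_val i.
pose R : 'M[{mpoly K[n]}]_k := \matrix_(i, j)
  if mdeg (x i) == e then r (x i) (x j) else 0.
pose q : 'cV[{mpoly K[n]}]_k := \col_i
  if mdeg (x i) == e then 'X_[x i] else 0.
have hq i : I (((1%:M - R) *m q) i 0).
  rewrite mulmxBl mul1mx !mxE.
  have [Di|Di] := eqVneq (mdeg (x i)) e; last first.
    rewrite sub0r big1 ?oppr0 // => j _.
    by rewrite !mxE (negbTE Di) mul0r.
  have [_ /(_ Di)] := hr (x i); congr (I (_ - _)).
  rewrite (reindex x) /=; last first.
    by exists enum_rank => j _; [exact: enum_valK|exact: enum_rankK].
  rewrite big_mkcond; apply: eq_bigr => j _.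
  by rewrite !mxE Di eqxx; case: ifP => // _; rewrite mulr0.
exists (\det (1%:M - R)); split.
  rewrite -[LHS]/(meval (fun=> 0) _) -det_map_mx.
  rewrite (_ : map_mx _ _ = 1%:M) ?det1 //.
  apply/matrixP => i j; rewrite !mxE raddfB /= -[RHS]subr0; congr (_ - _).
    by rewrite raddfMn /= meval1.
  by case: ifP => _; rewrite ?meval0 //; case: (hr (x i)).
move=> p; rewrite -[e]add0n => /deg_ge_split[s [_ ->]].
rewrite mulr_sumr; apply: ideal_sum => // b /eqP Db.
rewrite mulrCA; apply: (IM).
have := ideal_det_trick idI hq (enum_rank b).
by rewrite mxE /x enum_rankK Db eqxx.
Qed.

End Nakayama.

(** * Finite spanning sets modulo an ideal *)

Section Spanning.
Variables (K : fieldType) (n mu : nat).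
Variables (b : 'I_mu -> {mpoly K[n]}) (g : 'I_n -> {mpoly K[n]}).
Variable d : 'I_n -> nat.
Hypothesis d_gt0 : forall j, (0 < d j)%N.
Hypothesis wt_g : forall j, wt_ge (d j) (g j).
Hypothesis span_b : forall N p, exists (c : 'I_mu -> K) (h : 'I_n -> {mpoly K[n]}),
  wt_ge N.+1 (p - \sum_k c k *: b k - \sum_j h j * g j).
Implicit Types (p q : {mpoly K[n]}) (N : nat).

Let monomial_g (e : 'I_n -> nat) : {mpoly K[n]} := \prod_j g j ^+ e j.

Let wt_monomial_g e : wt_ge (\sum_j d j * e j) (monomial_g e).
Proof.
rewrite /monomial_g.
elim/big_rec2: _ => [|j w p _ hp]; first by rewrite -[X in wt_ge X]/0%N => a.
by apply: ord_geM => //; apply: ord_geMn.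
Qed.

Let spanned N p : Prop := exists c : 'I_mu * {ffun 'I_n -> 'I_N.+1} -> K,
  wt_ge N.+1 (p - \sum_(x in setX setT (simplex d N))
                    c x *: (b x.1 * monomial_g (fun j => x.2 j))).

Let spannedD N p q : spanned N p -> spanned N q -> spanned N (p + q).
Proof.
move=> [c hc] [c' hc']; exists (fun x => c x + c' x).
rewrite (_ : \sum_(x in _) _ =
  \sum_(x in setX setT (simplex d N)) c x *: (b x.1 * monomial_g (fun j => x.2 j))
  + \sum_(x in setX setT (simplex d N)) c' x *: (b x.1 * monomial_g (fun j => x.2 j))).
  by rewrite opprD addrACA; apply: ord_geD.
by rewrite -big_split; apply: eq_bigr => x _; rewrite scalerDl.
Qed.

Let spanned_high N p : wt_ge N.+1 p -> spanned N p.
Proof.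
by exists (fun=> 0); rewrite big1 ?subr0 // => x _; rewrite scale0r.
Qed.

Let spanned_sum N (J : Type) (r : seq J) (f : J -> {mpoly K[n]}) :
  (forall j, spanned N (f j)) -> spanned N (\sum_(j <- r) f j).
Proof.
move=> hf; elim/big_ind: _ => // ; first exact/spanned_high/ord_ge0.
by move=> p q; apply: spannedD.
Qed.

Let spanned_gen N k c (e : 'I_n -> nat) : (\sum_j d j * e j <= N)%N ->
  spanned N (c *: (b k * monomial_g e)).
Proof.
move=> le_e; have lt_e j : (e j < N.+1)%N.
  rewrite ltnS; apply: leq_trans le_e; apply: leq_trans (leq_term _ j).
  by rewrite leq_pmull.
pose a : {ffun 'I_n -> 'I_N.+1} := [ffun j => Ordinal (lt_e j)].
have ha : a \in simplex d N.
  by rewrite inE (eq_bigr (fun j => d j * e j)%N) // => j _; rewrite ffunE.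
exists (fun x => c *+ (x == (k, a))).
rewrite (bigD1 (k, a)) /= ?in_setX ?in_setT //= eqxx mulr1n.
rewrite big1 => [|x /andP[_ /negbTE->]]; last by rewrite mulr0n scale0r.
rewrite addr0 (_ : monomial_g (fun j => a j) = monomial_g e) ?subrr; first exact: ord_ge0.
by apply: eq_bigr => j _; rewrite ffunE.
Qed.

(** The expansion of q modulo the g_j is multiplied by a monomial in the g_j: the
    remainder is again of the form q' times a monomial, of higher order. After
    N + 1 steps the order exceeds N. *)
Let spanned_all N p : spanned N p.
Proof.
suff h t (e : 'I_n -> nat) q : (N < \sum_j d j * e j + t)%N ->
    spanned N (q * monomial_g e).
  rewrite -[p]mulr1 -[1](_ : monomial_g (fun=> 0%N) = 1).
    by apply: (h N.+1); rewrite leq_addl.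
  by rewrite /monomial_g big1 // => j _; apply: expr0.
elim: t e q => [|t IHt] e q lt_N.
  apply/spanned_high/ord_geMr; apply: ord_geW (@wt_monomial_g e).
  by rewrite -[X in (_ < X)%N]addn0.
case: (leqP (\sum_j d j * e j) N) => [le_e|lt_e]; last first.
  by apply/spanned_high/ord_geMr; apply: ord_geW (@wt_monomial_g e).
have [c [h hq]] := span_b N q.
rewrite (_ : q * _ = (q - \sum_k c k *: b k - \sum_j h j * g j) * monomial_g e +
  (\sum_k c k *: (b k * monomial_g e) + \sum_j h j * (g j * monomial_g e))).
  apply: spannedD; first by apply: spanned_high; rewrite mulrC; apply: ord_geMr.
  apply: spannedD; apply: spanned_sum => j; first exact: spanned_gen.
  rewrite (_ : g j * _ = monomial_g (fun i => (i == j) + e i)%N).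
    apply: IHt; apply: leq_trans lt_N _; rewrite addnS -addSn leq_add2r.
    under [in X in (_ <= X)%N]eq_bigr do rewrite mulnDr.
    rewrite big_split /= -add1n leq_add2r.
    by rewrite (bigD1 j) //= eqxx muln1 ltn_addr.
  rewrite /monomial_g; under [in RHS]eq_bigr do rewrite exprD.
  rewrite big_split /=; congr (_ * _); rewrite (bigD1 j) //= eqxx expr1.
  by rewrite big1 ?mulr1 // => i /negbTE->; rewrite expr0.
under [X in _ + (X + _)]eq_bigr do rewrite scalerAl.
under [X in _ + (_ + X)]eq_bigr do rewrite mulrA.
by rewrite -!mulr_suml -!mulrDl -[q - _ - _]addrA -opprD subrK.
Qed.

(** The monomials of weight at most N are linearly independent modulo order
    greater than N, so there are at most as many of them as there are
    generators; C and Q are the two matrices of coefficients. *)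
Lemma simplex_le_spanning N :
  (#|simplex (fun i : 'I_n => i.+1) N| <= mu * #|simplex d N|)%N.
Proof.
set A := simplex _ N; pose B := setX [set: 'I_mu] (simplex d N).
have -> : (mu * #|simplex d N|)%N = #|B| by rewrite cardsX cardsT card_ord.
pose mon (a : {ffun 'I_n -> 'I_N.+1}) : 'X_{1..n} := [multinom val (a i) | i < n].
have inj_mon : injective mon.
  move=> a a' /mnmP h; apply/ffunP => i; apply: val_inj.
  by have := h i; rewrite !mnmE.
have wt_mon a : a \in A -> (mnmwgt (mon a) <= N)%N.
  rewrite inE => le_a; rewrite /mnmwgt (eq_bigr (fun i : 'I_n => (i.+1 * a i)%N)) //.
  by move=> i _; rewrite mnmE mulnC.
have /fin_all_exists[c hc] := fun i : 'I_#|A| => spanned_all N 'X_[mon (enum_val i)].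
pose Q : 'M[K]_(#|B|, #|A|) := \matrix_(x < #|B|, j < #|A|)
  (b (enum_val x).1 * monomial_g (fun i => (enum_val x).2 i))@_(mon (enum_val j)).
pose C : 'M[K]_(#|A|, #|B|) := \matrix_(i, x) c i (enum_val x).
have CQ : C *m Q = 1%:M.
  apply/matrixP => i j; rewrite !mxE.
  have := hc i (mon (enum_val j)); rewrite ltnS => /(_ (wt_mon _ (enum_valP j))).
  rewrite mcoeffB mcoeffX (inj_eq inj_mon) (inj_eq enum_val_inj) => /eqP.
  rewrite subr_eq0 => /eqP ->; rewrite raddf_sum /= [RHS]big_enum_val /=.
  by apply: eq_bigr => x _; rewrite !mxE mcoeffZ.
rewrite -(mxrank1 K #|A|) -CQ; apply: leq_trans (mxrankM_maxr _ _) _.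
exact: rank_leq_row.
Qed.

End Spanning.

(** * The expansion of f_d at the point 1 *)

Section FiniteDifferences.
Variable K : comNzRingType.
Implicit Types (p q : {poly K}).

Definition alt_sum d (f : nat -> K) : K :=
  \sum_(k < d.+1) (-1) ^+ k * 'C(d, k)%:R * f k.

(** Pascal's rule: alt_sum d is, up to sign, the d-th finite difference at 0. *)
Lemma alt_sumS d f :
  alt_sum d.+1 f = alt_sum d (fun k => f k - f k.+1).
Proof.
rewrite /alt_sum big_ord_recl /=.
under eq_bigr => k _ do rewrite /bump /= add1n binS natrD mulrDr mulrDl.
rewrite big_split /= addrA.
have -> : \sum_(k < d.+1) (-1) ^+ k * 'C(d, k)%:R * (f k - f k.+1) =
  \sum_(k < d.+1) (-1) ^+ k * 'C(d, k)%:R * f k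
  + \sum_(k < d.+1) (-1) ^+ k.+1 * 'C(d, k)%:R * f k.+1.
  rewrite -big_split; apply: eq_bigr => k _ /=; rewrite exprS; ring.
congr (_ + _); rewrite big_ord_recr [RHS]big_ord_recl /=.
by rewrite (bin_small (ltnSn d)) mulr0 mul0r addr0 !bin0.
Qed.

Lemma coef_XD1n k j : (('X + 1) ^+ k : {poly K})`_j = 'C(k, j)%:R.
Proof.
rewrite addrC exprDn coef_sum; under eq_bigr => i _ do
  rewrite expr1n mul1r coefMn coefXn.
case: (ltnP j k.+1) => [lt_jk|lt_kj]; last first.
  rewrite bin_small // big1 // => i _.
  by rewrite gtn_eqF ?mul0rn //; apply: leq_trans (ltn_ord i) lt_kj.
rewrite (bigD1 (Ordinal lt_jk)) //= eqxx big1 ?addr0 // => i ne_i.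
rewrite (_ : (j == i) = false) ?mul0rn //; apply: contraNF ne_i => /eqP E.
exact/eqP/val_inj/esym.
Qed.

Lemma coef_shift d q j : (size q <= d)%N ->
  (q \Po ('X + 1))`_j = \sum_(i < d) q`_i * 'C(i, j)%:R.
Proof.
move=> le_q; rewrite coef_comp_poly.
rewrite (big_ord_widen _ (fun i => q`_i * (('X + 1) ^+ i)`_j) le_q).
rewrite big_mkcond /=; apply: eq_bigr => i _; rewrite coef_XD1n.
by case: ltnP => // le_i; rewrite nth_default ?mul0r.
Qed.

(** Each difference lowers the degree by one and multiplies the leading
    coefficient by the degree. *)
Lemma alt_sum_poly d q : (size q <= d.+1)%N ->
  alt_sum d (fun k => q.[k%:R]) = (-1) ^+ d * d`!%:R * q`_d.
Proof.
elim: d q => [|d IHd] q le_q.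
  rewrite /alt_sum big_ord1 bin0 (size1_polyC le_q) hornerC coefC eqxx.
  by rewrite !mul1r.
rewrite alt_sumS; pose q' := q - (q \Po ('X + 1)).
have -> : alt_sum d (fun k => q.[k%:R] - q.[k.+1%:R]) =
    alt_sum d (fun k => q'.[k%:R]).
  apply: eq_bigr => k _; congr (_ * _).
  by rewrite /= /q' hornerD hornerN horner_comp hornerD hornerX hornerC natr1.
have q'E j : q'`_j = q`_j - \sum_(i < d.+2) q`_i * 'C(i, j)%:R.
  by rewrite coefB (coef_shift _ le_q).
rewrite IHd.
  rewrite q'E !big_ord_recr /= big1 => [|i _]; last first.
    by rewrite bin_small ?mulr0n ?mulr0.
  rewrite binn (binSn d) factS natrM exprS; ring.
apply/leq_sizeP => j le_j; rewrite q'E.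
rewrite big_ord_recr /= big1 => [|i _]; last first.
  by rewrite bin_small ?mulr0n ?mulr0 //; apply: leq_trans (ltn_ord i) le_j.
move: le_j; rewrite leq_eqVlt => /orP[/eqP<-|lt_j].
  by rewrite binn add0r mulr1 subrr.
rewrite bin_small // mulr0n mulr0 addr0 nth_default ?subr0 //.
exact: leq_trans le_q lt_j.
Qed.

(** A formal leading coefficient: c may be 0, which makes the notion
    multiplicative without side conditions. *)
Definition top_coef k (c : K) p : Prop := (size p <= k.+1)%N /\ p`_k = c.

Lemma top_coefM k l c e p q :
  top_coef k c p -> top_coef l e q -> top_coef (k + l) (c * e) (p * q).
Proof.
move=> [hp <-] [hq <-]; split.
  apply: leq_trans (size_polyMleq _ _) _.
  by rewrite -subn1 leq_subLR add1n -addnS -addSn leq_add.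
rewrite coefM.
have lt_k : (k < (k + l).+1)%N by lia.
rewrite (bigD1 (Ordinal lt_k)) //= addKn big1 ?addr0 // => i ne_i.
have {}ne_i : nat_of_ord i != k by apply: contraNneq ne_i => e'; apply/eqP/val_inj.
case: (ltnP k i) => [lt_ki|le_ik].
  by rewrite [p`_i]nth_default ?mul0r //; apply: leq_trans hp lt_ki.
by rewrite [q`_ _]nth_default ?mulr0 //; apply: leq_trans hq _; lia.
Qed.

Lemma top_coef_prod (J : finType) (k : J -> nat) (c : J -> K) (p : J -> {poly K}) :
  (forall j, top_coef (k j) (c j) (p j)) ->
  top_coef (\sum_j k j) (\prod_j c j) (\prod_j p j).
Proof.
move=> hp; elim/big_rec3: _ => [|j x y z _ hz]; last exact: top_coefM.
by split; rewrite ?size_poly1 // coef1.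
Qed.
End FiniteDifferences.

Section Binomials.
Variable K : numFieldType.

Lemma natr_ffact N a : (N ^_ a)%:R = \prod_(l < a) (N%:R - l%:R) :> K.
Proof.
elim: a => [|a IHa]; first by rewrite big_ord0.
rewrite ffactnSr natrM IHa big_ord_recr /=.
case: (leqP a N) => [le_a|lt_N]; first by rewrite natrB.
by rewrite -IHa ffact_small ?mul0r.
Qed.

Definition bin_poly e a : {poly K} :=
  (a`!%:R)^-1 *: \prod_(l < a) ('X^e - l%:R%:P).

Lemma horner_bin_poly e a k : (bin_poly e a).[k%:R] = 'C(k ^ e, a)%:R.
Proof.
rewrite hornerZ horner_prod.
under eq_bigr => l _ do rewrite hornerD hornerN hornerC hornerXn -natrX.
rewrite -natr_ffact -bin_ffact natrM mulrC mulfK //.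
by rewrite pnatr_eq0 -lt0n fact_gt0.
Qed.

Lemma top_coef_bin_poly e a : (0 < e)%N -> top_coef (a * e) (a`!%:R)^-1 (bin_poly e a).
Proof.
move=> e0; rewrite /bin_poly -mul_polyC -[(a * e)%N]add0n -[X in top_coef _ X _]mulr1.
apply: top_coefM; first by split; rewrite ?size_polyC ?coefC //; case: (_ == 0).
have -> : (a * e = \sum_(l < a) e)%N by rewrite sum_nat_const card_ord.
rewrite -[X in top_coef _ X _](@big1 K 1 *%R 'I_a (index_enum _) xpredT (fun=> 1)) //.
apply: top_coef_prod => l; split; first by rewrite size_XnsubC.
by rewrite coefB coefXn eqxx coefC; case: (e) e0 => //= _ _; rewrite subr0.
Qed.

Variable n : nat.

Definition translate (s : K) (p : {mpoly K[n]}) : {mpoly K[n]} :=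
  p \mPo [tuple s%:MP + 'X_i | i < n].

Lemma mcoeff_prod1DX (e : 'I_n -> nat) (a : 'X_{1..n}) :
  (\prod_i (1 + 'X_i) ^+ e i : {mpoly K[n]})@_a = \prod_i 'C(e i, a i)%:R.
Proof.
pose B := (\sum_i e i + mdeg a)%N.
have le_a i : (a i <= B)%N by rewrite /B mdegE (bigD1 (F := a) i) //=; lia.
have le_e i : (e i <= B)%N by rewrite /B (bigD1 (F := e) i) //=; lia.
have expE i : (1 + 'X_i) ^+ e i =
    \sum_(j < B.+1) 'C(e i, j)%:R *: 'X_i ^+ j :> {mpoly K[n]}.
  pose t j : {mpoly K[n]} := 1 ^+ (e i - j) * 'X_i ^+ j *+ 'C(e i, j).
  rewrite exprDn (big_ord_widen _ t (le_e i : (_ < B.+1)%N)) /t.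
  rewrite big_mkcond; apply: eq_bigr => j _; rewrite expr1n mul1r scaler_nat.
  by case: ltnP => // lt_j; rewrite bin_small.
under eq_bigr => i _ do rewrite expE.
rewrite bigA_distr_bigA /= raddf_sum /=.
pose mon (f : {ffun 'I_n -> 'I_B.+1}) : 'X_{1..n} := [multinom val (f i) | i < n].
under eq_bigr => f _.
  rewrite scaler_prod.
  rewrite (_ : \prod_i 'X_i ^+ f i = 'X_[mon f]); last first.
    by rewrite mpolyXE_id; apply: eq_bigr => i _; rewrite mnmE.
  rewrite mcoeffZ mcoeffX.
  over.
pose f0 : {ffun 'I_n -> 'I_B.+1} := [ffun i => inord (a i)].
have monf0 : mon f0 = a.
  by apply/mnmP => i; rewrite mnmE ffunE /= inordK // ltnS.
rewrite (bigD1 f0) //= monf0 eqxx mulr1 [X in _ + X]big1 ?addr0 => [|f ne_f].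
  by apply: eq_bigr => i _; rewrite ffunE inordK // ltnS.
rewrite -monf0 (_ : (_ == _) = false) ?mulr0 //.
apply: contraNF ne_f => /eqP/mnmP h; apply/eqP/ffunP => i; apply: val_inj.
by have := h i; rewrite !mnmE.
Qed.

(** The polynomial f_d over any numeric field; for R[i] this is f_poly, by
    conversion. *)
Definition difference_poly d : {mpoly K[n]} :=
  \sum_(k < d.+1) ((-1) ^+ k * 'C(d, k)%:R) *:
    \prod_(i < n) 'X_i ^+ (k ^ i.+1)%N.

(** The coefficient is an alternating sum of prod_i binom(k ^ i.+1, a_i), a
    polynomial in k of degree the weight of a, so that alt_sum_poly applies. *)
Lemma mcoeff_difference_poly d (a : 'X_{1..n}) : (mnmwgt a <= d)%N ->
  (translate 1 (difference_poly d))@_a =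
    (-1) ^+ d * d`!%:R * (\prod_i (a i)`!%:R^-1 *+ (mnmwgt a == d)).
Proof.
move=> le_a; rewrite /translate /difference_poly.
rewrite (raddf_sum (comp_mpoly _)).
rewrite raddf_sum /=.
pose q := \prod_(i < n) bin_poly i.+1 (a i).
have [sq cq] : top_coef (mnmwgt a) (\prod_i (a i)`!%:R^-1) q.
  by apply: top_coef_prod => i; apply: top_coef_bin_poly.
rewrite (_ : \sum_(k < _) _ = alt_sum d (fun k => q.[k%:R])); last first.
  apply: eq_bigr => k _; rewrite linearZ /= mcoeffZ; congr (_ * _).
  rewrite rmorph_prod (eq_bigr (fun i => (1 + 'X_i) ^+ (k ^ i.+1)%N)) /=; last first.
    by move=> i _; rewrite rmorphXn /= comp_mpolyXU -tnth_nth tnth_mktuple.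
  rewrite mcoeff_prod1DX horner_prod; apply: eq_bigr => i _.
  by rewrite horner_bin_poly.
rewrite alt_sum_poly; last exact: leq_trans sq _.
congr (_ * _); move: le_a; rewrite leq_eqVlt.
case: eqVneq => [<- _|_ /= lt_a]; first by rewrite cq mulr1n.
by rewrite nth_default ?mulr0n //; apply: leq_trans sq _.
Qed.

Definition scaled_difference d : {mpoly K[n]} :=
  ((-1) ^+ d / d`!%:R) *: translate 1 (difference_poly d).

Lemma mcoeff_scaled_difference d a : (mnmwgt a <= d)%N ->
  (scaled_difference d)@_a = \prod_i (a i)`!%:R^-1 *+ (mnmwgt a == d).
Proof.
move=> le_a; rewrite mcoeffZ mcoeff_difference_poly // mulrA.
have -> : (-1) ^+ d / d`!%:R * ((-1) ^+ d * d`!%:R) = 1 :> K.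
  rewrite mulrACA -exprMn mulrNN mulr1 expr1n mul1r mulVf //.
  by rewrite pnatr_eq0 -lt0n fact_gt0.
by rewrite mul1r.
Qed.

Lemma scaled_difference0 : scaled_difference 0 = 1.
Proof.
rewrite /scaled_difference /difference_poly big_ord1 bin0.
rewrite big1 => [|i _]; last by rewrite exp0n ?expr0.
by rewrite /translate fact0 invr1 !mulr1 expr0 !scale1r rmorph1.
Qed.

Lemma wt_scaled_difference d : wt_ge d (scaled_difference d).
Proof.
move=> a lt_a; rewrite mcoeff_scaled_difference; last exact: ltnW.
by rewrite (ltn_eqF lt_a) mulr0n.
Qed.

Lemma mcoeffXM i p (a : 'X_{1..n}) :
  ('X_i * p : {mpoly K[n]})@_a = if (0 < a i)%N then p@_(a - U_(i)) else 0.
Proof.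
case: ifP => [ai|/negbT ai].
  by rewrite -{1}(mnm_subUK ai) addmC mulrC mcoeffMX.
apply: memN_msupp_eq0; apply/negP; rewrite mulrC (perm_mem (msuppMX _ _)).
by case/mapP => b _ Ea; move: ai; rewrite Ea mnmDE mnm1E eqxx.
Qed.

(** The recurrence d h_d = sum_i i h_(d-i) y_i for the initial forms
    h_d = sum_a y^a / a!: in the coefficient of y^a, the i-th term contributes
    i a_i / a!, and these numbers add up to wt(a) / a!. *)
Lemma scaled_difference_rec d : wt_ge d.+1
  (d%:R *: scaled_difference d - \sum_(i < n | (i < d)%N)
     i.+1%:R *: ('X_i * scaled_difference (d - i.+1))).
Proof.
move=> a; rewrite ltnS => le_a.
rewrite mcoeffB mcoeffZ mcoeff_scaled_difference // raddf_sum /=.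
pose c : K := \prod_i (a i)`!%:R^-1 *+ (mnmwgt a == d).
rewrite [X in _ - X](eq_bigr (fun i : 'I_n => c * (a i * i.+1)%:R)).
  rewrite /c.
  rewrite -mulr_sumr [X in _ - _ * X]big_mkcond /=.
  have [Da|_] := eqVneq (mnmwgt a) d; last by rewrite !mulr0n mul0r mulr0 subrr.
  rewrite [X in _ - _ * X](eq_bigr (fun i : 'I_n => (a i * i.+1)%:R)) => [|i _].
    rewrite -natr_sum (_ : (\sum_(i < n) a i * i.+1)%N = d); last exact: Da.
    by rewrite mulr1n mulrC subrr.
  case: ltnP => // le_di; rewrite (_ : a i = 0%N) ?mul0n //.
  apply/eqP; rewrite -leqn0 leqNgt; apply/negP => ai.
  have : (a i * i.+1 <= d)%N.
    by rewrite -Da /mnmwgt; apply: (leq_term (fun i => a i * i.+1)%N).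
  by rewrite leqNgt => /negP; apply; apply: leq_trans (leq_pmull _ ai).
move=> i lt_id; rewrite /c mcoeffZ mcoeffXM; case: ifP => [ai|/negbT]; last first.
  by rewrite -eqn0Ngt => /eqP->; rewrite mul0n !mulr0.
have Wa : mnmwgt a = (mnmwgt (a - U_(i))%MM + i.+1)%N.
  by rewrite -{1}(mnm_subUK ai) mnmwgtD mnmwgt1.
rewrite mcoeff_scaled_difference; last by lia.
have -> : (mnmwgt (a - U_(i)) == d - i.+1)%N = (mnmwgt a == d).
  by apply/eqP/eqP; lia.
case: (_ == d); last by rewrite !mulr0n mulr0 mul0r.
rewrite !mulr1n (bigD1 i) //= [in RHS](bigD1 i) //=.
rewrite mnmBE mnm1E eqxx subn1.
rewrite (eq_bigr (fun j => (a j)`!%:R^-1)) => [|j /negbTE ne_j]; last first.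
  by rewrite mnmBE mnm1E eq_sym ne_j subn0.
set P := \prod_(_ | _) _; case: (a i) ai => // k _ /=.
rewrite factS !natrM; field.
by rewrite nat1r !pnatr_eq0 -lt0n fact_gt0.
Qed.

End Binomials.

Section Translation.
Variables (K : numFieldType) (n : nat).
Implicit Types (p q : {mpoly K[n]}) (s t : K).

HB.instance Definition _ s :=
  GRing.RMorphism.copy (@translate K n s) (comp_mpoly [tuple s%:MP + 'X_i | i < n]).
HB.instance Definition _ s :=
  GRing.Linear.copy (@translate K n s) (comp_mpoly [tuple s%:MP + 'X_i | i < n]).

Lemma translateX s i : translate s 'X_i = s%:MP + 'X_i :> {mpoly K[n]}.
Proof. by rewrite /translate comp_mpolyXU -tnth_nth tnth_mktuple. Qed.

Lemma translateC s c : translate s c%:MP = c%:MP :> {mpoly K[n]}.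
Proof. exact: comp_mpolyC. Qed.

Lemma translateK s : cancel (@translate K n s) (translate (- s)).
Proof.
move=> p; rewrite [in LHS](mpolyE p) (raddf_sum (@translate K n s)).
rewrite (raddf_sum (@translate K n (- s))) /=.
transitivity (\sum_(a <- msupp p) p@_a *: 'X_[a] : {mpoly K[n]}); last by rewrite -mpolyE.
apply: eq_bigr => a _; rewrite !linearZ /= mpolyXE_id !rmorph_prod /=.
congr (_ *: _); apply: eq_bigr => i _; rewrite !rmorphXn /=.
by rewrite translateX rmorphD /= translateC translateX addrA -mpolyCD subrr mpolyC0 add0r.
Qed.

Lemma translateVK s : cancel (translate (- s)) (@translate K n s).
Proof. by move=> p; have := translateK (- s) p; rewrite opprK. Qed.

Lemma meval_translate s p v : (translate s p).@[v] = p.@[fun i => s + v i].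
Proof.
rewrite /translate comp_mpoly_meval; apply: meval_eq => i.
by rewrite tnth_mktuple mevalD mevalC mevalXU.
Qed.

End Translation.

(** * The ideal of the system near the point 1 *)

Lemma geometric_unit (A : comNzRingType) (r : A) N :
  (1 - r) * (\sum_(k < N) r ^+ k) = 1 - r ^+ N.
Proof. by rewrite -[1 - r]opprB mulNr -subrX1 opprB. Qed.

Definition in_sys (K : fieldType) n r (F : 'I_r -> {mpoly K[n]})
    (p : {mpoly K[n]}) : Prop :=
  exists g : 'I_r -> {mpoly K[n]}, p = \sum_j g j * F j.

Lemma in_sys_ideal (K : fieldType) n r (F : 'I_r -> {mpoly K[n]}) :
  is_ideal (in_sys F).
Proof.
split=> [|p q [c ->] [d ->]|q p [c ->]].
- by exists (fun=> 0); rewrite big1 // => j _; rewrite mul0r.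
- exists (fun j => c j + d j); rewrite -big_split.
  by apply: eq_bigr => j _; rewrite mulrDl.
- exists (fun j => q * c j); rewrite mulr_sumr.
  by apply: eq_bigr => j _; rewrite mulrA.
Qed.

Section LocalStructure.
Variables (K : numFieldType) (n m : nat).

Let F (j : 'I_n) : {mpoly K[n]} := difference_poly K n (m + j.+1).

Local Notation tau := (@translate K n 1).

(** The results at the origin are applied to the ideal translated by 1.  The
    orders by weight and by degree bound each other, which allows to feed the
    approximation by weight into nakayama, stated by degree. *)
Lemma local_nakayama : exists e u,
  u.@[fun=> 1] != 0 /\ forall p, deg_ge e (tau p) -> in_sys F (u * p).
Proof.
have [I0 ID IM] := in_sys_ideal F.
pose I' q := in_sys F (translate (- 1) q).
have idI' : is_ideal I'.
  split=> [|p q Ip Iq|r p Ip]; first by rewrite /I' rmorph0.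
    by rewrite /I' rmorphD; apply: ID.
  by rewrite /I' rmorphM; apply: IM.
have IG d : (m < d <= m + n)%N -> I' (scaled_difference K n d).
  move=> /andP[lt_md le_d]; rewrite /I' /scaled_difference.
  rewrite linearZ /= translateK -mul_mpolyC.
  apply: (IM); have lt_j : (d - m.+1 < n)%N by lia.
  exists (fun j => (j == Ordinal lt_j)%:R).
  rewrite (bigD1 (Ordinal lt_j)) //= eqxx mul1r.
  rewrite big1 => [|j /negbTE->]; last by rewrite mul0r.
  by rewrite addr0 /F /=; congr difference_poly; lia.
have [e he] := initial_approx idI' (scaled_difference0 K n)
  (@wt_scaled_difference K n) (@scaled_difference_rec K n) IG.
have [p hp|u [u1 hu]] := nakayama (e := e) idI'.
  have [|q [Iq hq]] := he e (n * e).+1 p (leqnn e).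
    by move=> a lt_a; apply: hp; apply: leq_ltn_trans (mdeg_le_wgt a) _.
  exists q; split=> // a lt_a; apply: hq; rewrite ltnS.
  by apply: leq_trans (wgt_le_mdeg a) _; rewrite leq_mul2l -ltnS lt_a orbT.
exists e, (translate (- 1) u); split.
  rewrite meval_translate (meval_eq _ (v2 := fun=> 0)) ?u1 ?oner_neq0 // => i.
  by rewrite addNr.
by move=> p /hu; rewrite /I' rmorphM /= translateK.
Qed.

Lemma is_solution_1 j : (F j).@[fun=> 1] = 0.
Proof.
rewrite -(meval_eq (v1 := fun i => 1 + 0)); last by move=> i; rewrite addr0.
rewrite -(meval_translate 1 (F j) (fun=> 0)) meval_0 /F.
rewrite mcoeff_difference_poly ?mnmwgt0 //.
by rewrite addnS mulr0n mulr0.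
Qed.

(** The hypothesis says that the classes of the b_k span the local algebra.  The
    unit v at 1 is inverted modulo high order by a geometric series, which puts
    the b_k in the situation of simplex_le_spanning. *)
Lemma multiplicity_lbound mu (b : 'I_mu -> {mpoly K[n]}) : (0 < n)%N ->
  (forall p, exists (c : 'I_mu -> K) v,
    v.@[fun=> 1] != 0 /\ in_sys F (v * (p - \sum_k c k *: b k))) ->
  ('C(n + m, n) <= mu)%N.
Proof.
move=> n_gt0 hb.
pose d (j : 'I_n) := (m + j.+1)%N.
have wtF j : wt_ge (d j) (tau (F j)).
  by move=> a lt_a; rewrite mcoeff_difference_poly ?ltn_eqF ?mulr0n ?mulr0 // ltnW.
have hspan N p : exists (c : 'I_mu -> K) (h : 'I_n -> {mpoly K[n]}),
    wt_ge N.+1 (p - \sum_k c k *: tau (b k) - \sum_j h j * tau (F j)).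
  have [c [v [v1 [h hh]]]] := hb (translate (- 1) p).
  pose s := (tau v).@[fun=> 0].
  have s0 : s != 0.
    rewrite /s meval_translate (meval_eq _ (v2 := fun=> 1)) // => i.
    by rewrite addr0.
  pose r := 1 - s^-1 *: tau v; pose q := p - \sum_k c k *: tau (b k).
  have r0 : deg_ge 1 r.
    apply: deg_ge1; rewrite mevalB meval1 mevalZ -/s mulVf //.
    by rewrite subrr.
  exists c, (fun j => (\sum_(k < N.+1) r ^+ k) * (s^-1 *: tau (h j))).
  have E : (1 - r) * q = \sum_j (s^-1 *: tau (h j)) * tau (F j).
    have := congr1 tau hh; rewrite rmorphM rmorphB /= translateVK !(raddf_sum tau) /=.
    under [X in p - X]eq_bigr do rewrite linearZ /=.
    rewrite -/q /r opprB addrC subrK -scalerAl => ->.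
    rewrite scaler_sumr; apply: eq_bigr => j _.
    by rewrite rmorphM scalerAl.
  under [X in _ - X]eq_bigr do rewrite -mulrA.
  rewrite -mulr_sumr -E mulrA [X in X * q]mulrC geometric_unit mulrBl mul1r.
  rewrite opprB addrC subrK; rewrite mulrC; apply: ord_geMr.
  apply: (@ord_geW _ _ _ _ (1 * N.+1)); first by rewrite mul1n.
  apply: ord_geMn => a lt_a; apply: r0.
  exact: leq_ltn_trans (mdeg_le_wgt a) _.
have d0 j : (0 < d j)%N by rewrite /d addnS.
have := simplex_count_bound n_gt0 (fun i : 'I_n => ltn0Sn i) d0
  (simplex_le_spanning d0 wtF hspan).
have fact_prod k : (\prod_(i < k) i.+1 = k`!)%N.
  elim: k => [|k IHk]; first by rewrite big_ord0.
  by rewrite big_ord_recr /= IHk factS mulnC.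
have prodd : (\prod_i d i * m`! = (n + m)`!)%N.
  rewrite /d; elim: (n) => [|k IHk]; first by rewrite big_ord0 mul1n.
  rewrite big_ord_recr /= mulnAC IHk addSn factS mulnC; congr (_ * _)%N; lia.
rewrite fact_prod -(leq_pmul2r (fact_gt0 m)) prodd.
have := bin_fact (leq_addr m n); rewrite addKn => <-.
by rewrite (mulnC n`! mu) -mulnA leq_pmul2r // muln_gt0 !fact_gt0.
Qed.

End LocalStructure.

(** * Finite dimension *)

Section FiniteDimension.
Variables (K : fieldType) (V : lmodType K).

Definition spans k (s : 'I_k -> V) : Prop :=
  forall x, exists c : 'I_k -> K, x = \sum_i c i *: s i.

Lemma spans_drop k (s : 'I_k.+1 -> V) (c : 'I_k.+1 -> K) i0 :
  spans s -> \sum_i c i *: s i = 0 -> c i0 != 0 -> spans (s \o lift i0).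
Proof.
move=> hs hc c0 x; have [d ->] := hs x.
have E : s i0 = \sum_i (- (c i0)^-1 * c (lift i0 i)) *: s (lift i0 i).
  move: hc; rewrite (bigD1_ord i0) //= => /(congr1 ( *:%R (c i0)^-1)).
  rewrite scaler0 scalerDr scalerA mulVf // scale1r => /eqP.
  rewrite addr_eq0 => /eqP->; rewrite scaler_sumr -sumrN; apply: eq_bigr => i _.
  by rewrite scalerA mulNr scaleNr.
exists (fun i => d i0 * (- (c i0)^-1 * c (lift i0 i)) + d (lift i0 i)).
rewrite (bigD1_ord i0) //= E scaler_sumr -big_split /=.
by apply: eq_bigr => i _; rewrite scalerDl scalerA.
Qed.

(** A subfamily of minimal size among those that span is free. *)
Lemma spans_basis k (s : 'I_k -> V) : spans s ->
  exists mu (t : 'I_mu -> 'I_k), spans (s \o t) /\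
    forall c : 'I_mu -> K, \sum_i c i *: s (t i) = 0 -> forall i, c i = 0.
Proof.
move=> hs; pose P mu := `[< exists t : 'I_mu -> 'I_k, spans (s \o t) >].
have exP : exists mu, P mu by exists k; apply/asboolP; exists id.
case: (ex_minnP exP) => mu /asboolP[t ht] min_mu; exists mu, t; split=> // c hc i.
apply/eqP/negP => /negP ci.
case: mu t ht min_mu c hc i ci => [|mu] t ht min_mu c hc i ci; first by case: (i).
have := min_mu mu; rewrite ltnn => absurd; apply/notF/absurd.
by apply/asboolP; exists (t \o lift i); apply: (spans_drop ht hc ci).
Qed.

Lemma basis_has_dim mu (b : 'I_mu -> V) : spans b ->
  (forall c : 'I_mu -> K, \sum_i c i *: b i = 0 -> forall i, c i = 0) ->
  inhabited (Vector.axiom mu V).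
Proof.
move=> hb free_b; have [c hc] := choice hb.
have uniq_c (u : 'I_mu -> K) x : x = \sum_i u i *: b i -> c x =1 u.
  move=> hx i; apply/eqP; rewrite -subr_eq0; apply/eqP.
  apply: (free_b (fun i => c x i - u i)).
  under eq_bigr => j _ do rewrite scalerBl.
  by rewrite sumrB -hc -hx subrr.
split; exists (fun x => \row_i c x i).
  move=> a x y; apply/rowP => i; rewrite !mxE.
  apply: (uniq_c (fun i => a * c x i + c y i)).
  under eq_bigr => j _ do rewrite scalerDl -scalerA.
  by rewrite big_split /= -scaler_sumr -!hc.
exists (fun u : 'rV[K]_mu => \sum_i u 0 i *: b i) => [x|u].
  by rewrite [RHS]hc; apply: eq_bigr => i _; rewrite mxE.
by apply/rowP => i; rewrite mxE (uniq_c (fun i => u 0 i)).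
Qed.

End FiniteDimension.

(** * The local algebra *)

Local Open Scope quotient_scope.

Section LocalClasses.
Variables (K : fieldType) (n r : nat) (F : 'I_r -> {mpoly K[n]}).
Variables (a : 'I_n -> K) (sol : is_solution F a).
Implicit Types (p q u : {mpoly K[n]}).

Let piQ p : quot_alg sol := \pi_(quot_alg sol) p.

Lemma pi_eq0 p : piQ p = 0 <-> in_sys F p.
Proof.
rewrite -(rmorph0 (\pi_(quot_alg sol))) /piQ; split.
  by move/eqP; rewrite -Quotient.idealrBE subr0 => /asboolP.
by move=> Ip; apply/eqP; rewrite -Quotient.idealrBE subr0; apply/asboolP.
Qed.

Definition poly_loc p : local_alg sol :=
  loc_class (mkfrac (piQ p) (rpred1 (@nonvanishing K n r F a sol))).

Lemma poly_locD p q : poly_loc (p + q) = poly_loc p + poly_loc q.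
Proof.
rewrite /poly_loc -[RHS]/(loc_add _ _) loc_addE; apply/loc_classP; exists 1.
  exact: rpred1.
by rewrite /piQ rmorphD /= /fnum /fden /= !mulr1 subrr mulr0.
Qed.

Lemma poly_locZ c p : poly_loc (c *: p) = c *: poly_loc p.
Proof.
rewrite /poly_loc -[RHS]/(loc_scale _ _) loc_scaleE; apply/loc_classP; exists 1.
  exact: rpred1.
have -> : piQ (c *: p) = c *: piQ p by exact/esym/pi_scale.
by rewrite /fnum /fden /= !mulr1 subrr mulr0.
Qed.

Lemma poly_loc_eq0 p : poly_loc p = 0 <-> exists2 u, u.@[a] != 0 & in_sys F (u * p).
Proof.
split.
  move=> /loc_classP[_ /asboolP[u ua ->]]; rewrite /fnum /fden /= !mulr1 subr0.
  by rewrite -[X in _ * X]/(piQ p) -rmorphM => /pi_eq0; exists u.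
case=> u ua /pi_eq0 Iup; apply/loc_classP; exists (piQ u).
  by apply/asboolP; exists u.
by rewrite /fnum /fden /= !mulr1 subr0 /piQ -rmorphM.
Qed.

Lemma poly_loc_sum (J : Type) (s : seq J) (P : pred J) (c : J -> K)
    (f : J -> {mpoly K[n]}) :
  poly_loc (\sum_(j <- s | P j) c j *: f j) =
  \sum_(j <- s | P j) c j *: poly_loc (f j).
Proof.
rewrite (big_morph poly_loc poly_locD (_ : poly_loc 0 = 0)).
  by apply: eq_bigr => j _; rewrite poly_locZ.
by rewrite -[0 in LHS](scale0r (0 : {mpoly K[n]})) poly_locZ scale0r.
Qed.

(** If t inverts the denominator s up to an element killed by a unit, then
    y / s = (y t) / 1. *)
Lemma poly_loc_surj :
  (forall s, s.@[a] != 0 -> exists t u, u.@[a] != 0 /\ in_sys F (u * (1 - t * s))) ->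
  forall x, exists p, x = poly_loc p.
Proof.
move=> inv; elim/loc_ind => -[y [z Sz]].
have /asboolP[s sa zE] := Sz.
have [t [u [ua /pi_eq0 Iu]]] := inv s sa.
exists (repr y * t); apply/loc_classP; exists (piQ u); first by apply/asboolP; exists u.
rewrite /fnum /fden /= mulr1 zE /piQ rmorphM /= reprK.
move: Iu; rewrite /piQ rmorphM rmorphB rmorph1 rmorphM /= => Iu.
set T := \pi t; set S := \pi s; set U := \pi u.
have -> : U * (y - y * T * S) = y * (U * (1 - T * S)) by ring.
by rewrite Iu mulr0.
Qed.

End LocalClasses.

(** * Continuity *)

Section Continuity.
Local Open Scope classical_set_scope.
Import normedtype pseudometric_normed_Zmodule normed_module matrix_normedtype.
Import numFieldNormedType.Exports.
Variables (K : numFieldType) (n : nat).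

Section Combinations.
Variable T : topologicalType.
Implicit Types f g : T -> K^o.

Lemma continuous_const (c : K) : continuous (fun _ : T => c : K^o).
Proof. by move=> x; apply: cvg_cst. Qed.

Lemma continuous_mul f g :
  continuous f -> continuous g -> continuous (fun x => f x * g x).
Proof. by move=> hf hg x; apply: (@cvgM K); [exact: hf|exact: hg]. Qed.

Lemma continuous_exp f k : continuous f -> continuous (fun x => f x ^+ k).
Proof.
move=> hf; elim: k => [|k IHk] x.
  by under eq_fun do rewrite expr0; apply: cvg_cst.
by under eq_fun do rewrite exprS; apply: continuous_mul.
Qed.

Lemma continuous_prod (J : Type) (r : seq J) (F : J -> T -> K^o) :
  (forall j, continuous (F j)) -> continuous (fun x => \prod_(j <- r) F j x).
Proof.
move=> hF; elim: r => [|j r IHr] x.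
  by under eq_fun do rewrite big_nil; apply: cvg_cst.
by under eq_fun do rewrite big_cons; apply: continuous_mul.
Qed.

Lemma continuous_sum (J : Type) (r : seq J) (F : J -> T -> K^o) :
  (forall j, continuous (F j)) -> continuous (fun x => \sum_(j <- r) F j x).
Proof.
move=> hF; elim: r => [|j r IHr] x.
  by under eq_fun do rewrite big_nil; apply: cvg_cst.
under eq_fun do rewrite big_cons.
by apply: (@cvgD K K^o); [exact: hF|exact: IHr].
Qed.

Lemma continuous_meval (v : T -> 'rV[K^o]_n) (p : {mpoly K[n]}) :
  (forall i, continuous (fun x => v x 0 i)) ->
  continuous (fun x => p.@[v x 0] : K^o).
Proof.
move=> hv; apply: (@continuous_sum _ _ (fun a x => p@_a * \prod_i v x 0 i ^+ a i)) => a.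
apply: (@continuous_mul (fun=> p@_a)); first exact: continuous_const.
by apply: continuous_prod => i; apply: continuous_exp.
Qed.
End Combinations.

Lemma meval_continuous (p : {mpoly K[n]}) :
  continuous (fun x : 'rV[K^o]_n => p.@[x 0] : K^o).
Proof.
apply: (@continuous_meval _ id) => i; exact: (@coord_continuous K).
Qed.

Lemma nbhs_meval_neq0 (p : {mpoly K[n]}) (a : 'rV[K^o]_n) :
  p.@[a 0] != 0 -> nbhs a [set x : 'rV[K^o]_n | p.@[x 0] != 0].
Proof.
move=> pa; have h : nbhs (p.@[a 0] : K^o) (~` [set 0 : K^o]).
  apply: open_nbhs_nbhs; split; last exact/eqP.
  apply: closed_openC; apply: accessible_closed_set1.
  exact/hausdorff_accessible/(@norm_hausdorff K).
rewrite (_ : [set x | _] = (fun x : 'rV[K^o]_n => p.@[x 0]) @^-1` (~` [set 0])).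
  exact: (@meval_continuous p a _ h).
by apply/seteqP; split => x /= /eqP.
Qed.

End Continuity.

(** * Multiplicity *)

Local Open Scope complex_scope.

Section Multiplicity.
Variables (K : numFieldType) (n m : nat).
Hypothesis n_gt0 : (0 < n)%N.
Let F (j : 'I_n) : {mpoly K[n]} := difference_poly K n (m + j.+1).
Local Notation tau := (@translate K n 1).

(** With e and u from local_nakayama, a denominator s with s(1) <> 0 has an
    inverse modulo the e-th power of the maximal ideal, given by a geometric
    series, and that power vanishes in the local algebra.  So the classes of the
    monomials in x - 1 of degree less than e span it, a basis can be chosen among
    them, and multiplicity_lbound applies to this basis. *)
Lemma local_alg_dim (sol : is_solution F (fun=> 1)) :
  exists mu, has_dim (local_alg sol) mu /\ ('C(n + m, n) <= mu)%N.
Proof.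
have [e [u [u1 hu]]] := local_nakayama K n m.
have inv s : s.@[fun=> 1] != 0 ->
    exists t v, v.@[fun=> 1] != 0 /\ in_sys F (v * (1 - t * s)).
  set s1 := s.@[_] => s10; pose r := 1 - s1^-1 *: s.
  exists ((\sum_(k < e) r ^+ k) * s1^-1%:MP), u; split=> //.
  rewrite -mulrA mul_mpolyC -[s1^-1 *: s](subKr 1) -/r mulrC.
  rewrite mulrC [_ * (1 - r)]mulrC geometric_unit subKr; apply: hu.
  rewrite rmorphXn; apply: (@ord_geW _ _ _ _ (1 * e)); first by rewrite mul1n.
  apply: ord_geMn; apply: deg_ge1; rewrite meval_translate.
  rewrite (meval_eq _ (v2 := fun=> 1)) => [|i]; last by rewrite addr0.
  by rewrite mevalB meval1 mevalZ mulVf ?subrr.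
have surj := poly_loc_surj (sol := sol) inv.
pose T := [set: 'X_{1..n < e}].
pose g (x : 'X_{1..n < e}) : {mpoly K[n]} := translate (- 1) 'X_[x].
have spanning : spans (fun i : 'I_#|T| => poly_loc sol (g (enum_val i))).
  move=> x; have [p ->] := surj x.
  pose low : {mpoly K[n]} := \sum_(y : 'X_{1..n < e}) (tau p)@_y *: 'X_[y].
  exists (fun i : 'I_#|T| => (tau p)@_(enum_val i : 'X_{1..n < e})).
  rewrite -poly_loc_sum.
  have <- : translate (- 1) low =
      \sum_(i < #|T|) (tau p)@_(enum_val i : 'X_{1..n < e}) *: g (enum_val i).
    rewrite -(big_enum_val (fun y : 'X_{1..n < e} => (tau p)@_y *: g y)) /=.
    rewrite (raddf_sum (@translate K n (- 1))).
    by apply: eq_big => [y|y _]; [rewrite inE|rewrite /= linearZ].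
  apply/eqP; rewrite -subr_eq0 -scaleN1r -poly_locZ -poly_locD scaleN1r.
  apply/eqP/poly_loc_eq0; exists u => //; apply: hu.
  rewrite rmorphB /= translateVK => y lt_y.
  by rewrite mcoeffB (mcoeff_mpoly (fun y => (tau p)@_y)) // subrr.
have [mu [t [span_t free_t]]] := spans_basis spanning.
exists mu; split; first exact: basis_has_dim span_t free_t.
apply: (multiplicity_lbound n_gt0 (b := fun i => g (enum_val (t i)))) => p.
have [c /= hc] := span_t (poly_loc sol p).
have /poly_loc_eq0[v v1 Iv] : poly_loc sol (p - \sum_i c i *: g (enum_val (t i))) = 0.
  by rewrite -scaleN1r poly_locD poly_locZ scaleN1r poly_loc_sum hc subrr.
by exists c, v.
Qed.

End Multiplicity.

(** On the neighbourhood of 1 where the polynomial u of local_nakayama does not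
    vanish, u(x) (x_i - 1)^e = 0 forces x_i = 1. *)
Lemma isolated_one (R : realType) (n m : nat) :
  isolated (solution_set (@f_system R m n)) (const_mx 1 : 'rV[R[i]^o]_n).
Proof.
have [e [u [u1 hu]]] := local_nakayama R[i] n m.
have one : (const_mx 1 : 'rV[R[i]^o]_n) 0 = fun=> 1.
  by apply/funext => i; rewrite mxE.
split.
  by apply/mem_set; rewrite /solution_set /= one => j; apply: is_solution_1.
exists [set x : 'rV[R[i]^o]_n | u.@[x 0] != 0]%classic.
  by apply: nbhs_meval_neq0; rewrite one.
apply/seteqP; split=> [x [/= ux sol_x]|_ ->]; last first.
  split; first by rewrite /= one.
  by rewrite /solution_set /= one => j; apply: is_solution_1.
apply/rowP => i; rewrite mxE.
have [|c hc] := hu (('X_i - 1) ^+ e).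
  rewrite rmorphXn /= rmorphB rmorph1 /= translateX mpolyC1 addrC addKr => y lt_y.
  rewrite mcoeffXn; case: eqP lt_y => // <-.
  by rewrite mdegMn mdeg1 mul1n ltnn.
have : (u * ('X_i - 1) ^+ e).@[x 0] = 0.
  rewrite hc raddf_sum big1 // => j _.
  by rewrite /= mevalM [X in _ * X](sol_x j) mulr0.
rewrite mevalM rmorphXn /= mevalB mevalXU meval1 => /eqP.
by rewrite mulf_eq0 (negbTE ux) /= expf_eq0 subr_eq0 => /andP[_ /eqP].
Qed.

Theorem theorem7p4 (R : realType) (n m : nat) (hn : (1 <= n)%N) (hm : (1 <= m)%N) :
  exists mu : nat,
    has_multiplicity (@f_system R m n) (const_mx 1 : 'rV[R[i]^o]_n) mu
    /\ ('C(n + m, n) <= mu)%N.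
Proof.
have one : (const_mx 1 : 'rV[R[i]^o]_n) 0 = fun=> 1.
  by apply/funext => i; rewrite mxE.
have sol : is_solution (@f_system R m n) (fun=> 1).
  by move=> j; apply: is_solution_1.
have [mu [dim_mu le_mu]] := local_alg_dim hn sol.
exists mu; split=> //; split; first exact: isolated_one.
by move: ((const_mx 1 : 'rV[R[i]^o]_n) 0) one => a ->; exists sol.
Qed.
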